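(* Let $(\Omega,\mu)$ be a complete measure space with $\mu(\Omega)=\infty$, and let $\tau:\Omega\to\Omega$ be a measure preserving transformation. Assume that $E=E(\Omega)$ is a fully symmetric space such that $\mathbf 1=\chi_\Omega\notin E$. Then for every $f\in E$ there exists a set $\Omega_f\subset\Omega$ with $\mu(\Omega\setminus\Omega_f)=0$ such that the sequence $$\frac1n\sum_{k=0}^{n-1}b_kf(\tau^k\omega)$$ converges for every $\omega\in\Omega_f$ and every bounded Besicovitch sequence $\{b_k\}_{k=0}^\infty$.
   Context: Functions are complex-valued; elements of $E$ are classes of a.e. equal functions, and pointwise values $f(\tau^k\omega)$ refer to a fixed representative. For $f\in\mathcal L^1+\mathcal L^\infty$ the non-increasing rearrangement is $\mu_t(f)=\inf\{\lambda>0:\mu\{|f|>\lambda\}\le t\}$, $t>0$. A Banach space $(E,\|\cdot\|_E)$ that is a linear subspace of $\mathcal L^1+\mathcal L^\infty$ is called fully symmetric if $f\in E$, $g\in\mathcal L^1+\mathcal L^\infty$ and $\int_0^s\mu_t(g)\,dt\le\int_0^s\mu_t(f)\,dt$ for all $s>0$ imply $g\in E$ and $\|g\|_E\le\|f\|_E$. A function $P:\mathbb Z\to\mathbb C$ is a trigonometric polynomial if $P(k)=\sum_{j=1}^s z_j\lambda_j^k$, $k\in\mathbb Z$, for some $s\in\mathbb N$, $z_1,\dots,z_s\in\mathbb C$ and $\lambda_1,\dots,\lambda_s\in\mathbb C$ with $|\lambda_j|=1$. A sequence $\{b_k\}_{k=0}^\infty\subset\mathbb C$ is a bounded Besicovitch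 sequence if (i) $|b_k|\le C<\infty$ for all $k$ and (ii) for every $\epsilon>0$ there is a trigonometric polynomial $P$ with $\limsup_n\frac1n\sum_{k=0}^{n-1}|b_k-P(k)|<\epsilon$. *)

(* Defs.v *)
From HB Require Import structures.
From mathcomp Require Import all_boot all_order all_algebra.
From mathcomp Require Import all_classical all_reals all_analysis.
From mathcomp Require Import complex.

Set Implicit Arguments.
Unset Strict Implicit.
Unset Printing Implicit Defensive.
Import Order.TTheory GRing.Theory Num.Theory.
Import numFieldNormedType.Exports.

Local Open Scope classical_set_scope.
Local Open Scope ring_scope.
Local Open Scope complex_scope.

(* The norm `|z| of R[i] takes its values in R[i]; [cabs z] is the same modulus
   as an element of R. *)
Notation cabs := ComplexField.Normc.normc (only parsing).

Section function_spaces.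
Context d (T : measurableType d) (R : realType).
Variable mu : {measure set T -> \bar R}.
Implicit Types f g h : T -> R[i].

Definition cmeasurable f : Prop :=
  measurable_fun setT (fun x => complex.Re (f x)) /\
  measurable_fun setT (fun x => complex.Im (f x)).

Definition cLp (p : \bar R) f : Prop :=
  cmeasurable f /\ ('N[mu]_p[EFin \o (@cabs R) \o f] < +oo)%E.

Definition L1_plus_Loo f : Prop :=
  exists g h, [/\ cLp 1%E g, cLp +oo%E h & f = (fun x => g x + h x)].

Definition rearrangement f (t : R) : \bar R :=
  ereal_inf [set l%:E | l in
    [set l : R | 0 < l /\ (mu [set x | (l < cabs (f x))%R] <= t%:E)%E]].

(* [g] is submajorized by [f] in the sense of Hardy, Littlewood and Polya. *)
Definition submajorized g f : Prop :=
  forall s : R, 0 < s ->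
    (\int[@lebesgue_measure R]_(t in `]0%R, s]) rearrangement g t
     <= \int[@lebesgue_measure R]_(t in `]0%R, s]) rearrangement f t)%E.

Section embedded_space.
(* Elements of a function space are classes of a.e. equal functions: here they
   are the points of an abstract Banach space [E], and [rep x] is some
   representative of the class [x]. Consequently [rep] is linear and injective
   only up to a.e. equality. *)
Variables (E : completeNormedModType R[i]) (rep : E -> T -> R[i]).

Record subspace_of_L1_plus_Loo : Prop := {
  rep_L1_plus_Loo : forall x, L1_plus_Loo (rep x);
  rep_linear : forall (a : R[i]) (x y : E),
    rep (a *: x + y) = (fun w => a * rep x w + rep y w) %[ae mu];
  rep_injective : forall x y : E, rep x = rep y %[ae mu] -> x = y }.

(* [f] is a representative of the class [x]. *)
Definition represents f (x : E) : Prop := cmeasurable f /\ f = rep x %[ae mu].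

(* [f] belongs to [E] as a function. *)
Definition in_space f : Prop := exists x, represents f x.

Definition fully_symmetric : Prop :=
  subspace_of_L1_plus_Loo /\
  forall f (x : E) g, represents f x -> L1_plus_Loo g -> submajorized g f ->
    exists2 y : E, represents g y & `|y| <= `|x|.

End embedded_space.

Definition measure_preserving (tau : T -> T) : Prop :=
  measurable_fun setT tau /\
  forall A, measurable A -> mu (tau @^-1` A) = mu A.

End function_spaces.

Section besicovitch.
Context (R : realType).

Definition trigonometric_polynomial (P : int -> R[i]) : Prop :=
  exists (s : nat) (z lam : 'I_s -> R[i]),
    (forall j, `|lam j| = 1) /\
    forall k : int, P k = \sum_(j < s) z j * lam j ^ k.

Definition bounded_besicovitch (b : nat -> R[i]) : Prop :=
  (exists C : R, forall k, cabs (b k) <= C) /\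
  forall eps : R, 0 < eps ->
    exists2 P : int -> R[i], trigonometric_polynomial P &
      (limn_esup (fun n : nat =>
         (n%:R^-1 * \sum_(k < n) cabs (b k - P k%:Z))%:E) < eps%:E)%E.

End besicovitch.

(* R[i] carries its topology through the alias R[i]^o. *)
Definition weighted_average (R : realType) (T : Type) (tau : T -> T)
    (b : nat -> R[i]) (f : T -> R[i]) (w : T) (n : nat) : R[i]^o :=
  n%:R^-1 * \sum_(k < n) b k * f (iter k tau w).

(* Main.v *)
(* Since 1 is not in E, every f in E has level sets {|f| > l} of finite measure
   for l > 0, so f is the sum of a uniformly small function, of a bounded
   function g with support of finite measure, and of a function which is small
   in L^1.  The first part is harmless for bounded weights, and the third one is
   controlled by the maximal ergodic inequality; approximating the weights by
   trigonometric polynomials reduces the theorem to Wiener-Wintner for g: almost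
   every point x is good for all the weights l^k, |l| = 1, at once.

   For one l, or more generally for a tau-invariant measurable unimodular
   function phi, the averages of phi^k (g o tau^k) converge almost everywhere:
   this is the pointwise ergodic theorem for the isometry u |-> phi (u o tau) of
   L^2.  Near-minimizers of the norm over g + {u - phi (u o tau)} replace the
   mean ergodic projection, so that completeness of L^2 is not needed.

   At a given x, by van der Corput, the averages are small for all l outside the
   set of "peaks", those l at which the quadratic means of the averages over
   windows of length H stay large for all H (the atoms of the spectral measure
   of the sequence g (tau^k x)).  Bessel's inequality makes the set of peaks of
   a given height finite.  It is also tau-invariant, so the first peak within a
   given rational interval is an invariant measurable function of x, to which
   the twisted ergodic theorem applies; countably many such functions exhaust
   all the peaks. *)

Require Import Defs.
From mathcomp Require Import all_boot all_order all_algebra.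
From mathcomp Require Import all_classical all_reals all_analysis.
From mathcomp Require Import complex.
From mathcomp Require Import measurable_realfun ess_sup_inf.
From mathcomp Require Import ring lra.
Import Order.TTheory GRing.Theory Num.Theory.
Import numFieldNormedType.Exports.
Local Open Scope classical_set_scope.
Local Open Scope ring_scope.
Local Open Scope complex_scope.
Set Implicit Arguments.
Unset Strict Implicit.
Unset Printing Implicit Defensive.

(** * Cesàro averages *)

(** Since [0^-1 = 0], the average over the empty range is 0; hence the assumption [0 <= B] or a
    separate case [n = 0] in several estimates below. *)
Definition avg (K : fieldType) (u : nat -> K) (n : nat) : K :=
  n%:R^-1 * \sum_(k < n) u k.

Section averages.
Context (K : fieldType).
Implicit Types u v : nat -> K.

Lemma eq_avg u v : u =1 v -> avg u =1 avg v.
Proof. by move=> uv n; rewrite /avg; congr (_ * _); apply: eq_bigr. Qed.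

Lemma avgD u v n : avg (fun k => u k + v k) n = avg u n + avg v n.
Proof. by rewrite /avg big_split mulrDr. Qed.

Lemma avgB u v n : avg (fun k => u k - v k) n = avg u n - avg v n.
Proof. by rewrite /avg sumrB mulrBr. Qed.

Lemma avgZ c u n : avg (fun k => c * u k) n = c * avg u n.
Proof. by rewrite /avg -mulr_sumr mulrCA. Qed.

Lemma avg_sum (I : finType) (u : I -> nat -> K) n :
  avg (fun k => \sum_i u i k) n = \sum_i avg (u i) n.
Proof. by rewrite /avg exchange_big /= mulr_sumr. Qed.


Lemma avg1 u : avg u 1 = u 0%N.
Proof. by rewrite /avg big_ord_recl big_ord0 addr0 invr1 mul1r. Qed.

Lemma avgS_sub u n : avg (fun k => u k.+1) n - avg u n = n%:R^-1 * (u n - u 0%N).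
Proof.
rewrite /avg -mulrBr -sumrB -(big_mkord xpredT (fun k => u k.+1 - u k)).
by rewrite telescope_sumr.
Qed.

End averages.

Lemma avg_cst (K : numFieldType) (c : K) n : (0 < n)%N -> avg (fun=> c) n = c.
Proof.
by move=> n0; rewrite /avg sumr_const card_ord -[c *+ n]mulr_natl mulKf// pnatr_eq0 -lt0n.
Qed.

Lemma exists_half_pow_le (R : archiRealFieldType) (c e : R) : 0 <= c -> 0 < e ->
  exists k, c * 2^-1 ^+ k <= e.
Proof.
move=> c0 e0; exists (Num.truncn (c / e)).+1; set k := _.+1.
rewrite exprVn ler_pdivrMr ?exprn_gt0// mulrC -ler_pdivrMr//.
rewrite (le_trans (ltW (truncnS_gt _)))// -/k -natrX ler_nat.
by rewrite ltnW// ltn_expl.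
Qed.

Lemma exists_inv_nat_le (R : archiRealFieldType) (c e : R) : 0 <= c -> 0 < e ->
  exists N, forall n, (N <= n)%N -> n%:R^-1 * c <= e.
Proof.
move=> c0 e0; exists (Num.truncn (c / e)).+1 => n Nn.
have n0 : 0 < n%:R :> R by rewrite ltr0n (leq_ltn_trans _ Nn).
rewrite mulrC ler_pdivrMr// mulrC -ler_pdivrMr//.
by rewrite (le_trans (ltW (truncnS_gt _)))// ler_nat.
Qed.

Section real_averages.
Context (R : realFieldType).
Implicit Types u v : nat -> R.

Lemma ler_avg u v n : (forall k, u k <= v k) -> avg u n <= avg v n.
Proof.
by move=> uv; rewrite ler_wpM2l ?invr_ge0// ler_sum.
Qed.

Lemma avg_ge0 u n : (forall k, 0 <= u k) -> 0 <= avg u n.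
Proof. by move=> u0; rewrite mulr_ge0 ?invr_ge0// sumr_ge0. Qed.

Lemma avg_le_cst u n B : 0 <= B -> (forall k, (k < n)%N -> u k <= B) ->
  avg u n <= B.
Proof.
move=> B0 uB; case: n uB => [|n] uB; first by rewrite /avg big_ord0 mulr0.
rewrite /avg mulrC ler_pdivrMr//.
rewrite (@le_trans _ _ (\sum_(k < n.+1) B))//.
  by apply: ler_sum => k _; exact: uB.
by rewrite sumr_const card_ord mulr_natr.
Qed.

(** Nonnegativity of the variance: with [c] the mean, the difference of the two sides is the average
    of [(u k - c) ^+ 2]. *)
Lemma sqr_avg_le u n : avg u n ^+ 2 <= avg (fun k => u k ^+ 2) n.
Proof.
case: n => [|n]; first by rewrite /avg !big_ord0 !mulr0 expr0n.
set c := avg u n.+1.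
rewrite -subr_ge0.
suff -> : avg (fun k => u k ^+ 2) n.+1 - c ^+ 2 = avg (fun k => (u k - c) ^+ 2) n.+1.
  by apply: avg_ge0 => k; exact: sqr_ge0.
have -> : avg (fun k => (u k - c) ^+ 2) n.+1 =
    avg (fun k => u k ^+ 2 - (2 * c) * u k + c ^+ 2 * 1) n.+1.
  by apply: eq_avg => k; ring.
rewrite avgD avgB !avgZ -/c.
by rewrite avg_cst//; ring.
Qed.

End real_averages.

(** * The modulus on [R[i]] and averages of complex sequences *)

Section modulus.
Context (R : rcfType).
Implicit Types (x y z : R[i]).

Lemma cabs_ge0 x : 0 <= cabs x.
Proof. by case: x => a b /=; exact: sqrtr_ge0. Qed.

Lemma normE x : `|x| = (cabs x)%:C.
Proof. by case: x. Qed.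

Lemma cabsX x n : cabs (x ^+ n) = cabs x ^+ n.
Proof.
elim: n => [|n IH]; first by rewrite !expr0 ComplexField.Normc.normc1.
by rewrite !exprS ComplexField.Normc.normcM IH.
Qed.

Lemma cabsB x y : cabs (x - y) = cabs (y - x).
Proof. by apply: (@complexI R); rewrite -!normE distrC. Qed.

Lemma ler_cabsD x y : cabs (x + y) <= cabs x + cabs y.
Proof. by rewrite -lecR rmorphD /= -!normE ler_normD. Qed.

Lemma ler_cabsB x y : cabs (x - y) <= cabs x + cabs y.
Proof. by rewrite -lecR rmorphD /= -!normE ler_normB. Qed.

Lemma ler_cabs_dist z x y : cabs (x - y) <= cabs (x - z) + cabs (z - y).
Proof. by rewrite -lecR rmorphD /= -!normE ler_distD. Qed.

Lemma ler_cabs_distl x y : `|cabs x - cabs y| <= cabs (x - y).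
Proof.
rewrite ler_norml; apply/andP; split.
  rewrite lerBrDl addrC -lerBrDl opprK; have := ler_cabsD (y - x) x.
  by rewrite subrK cabsB addrC.
by have := ler_cabsD (x - y) y; rewrite subrK -lerBlDr.
Qed.

Lemma cabs_real (a : R) : cabs a%:C = `|a|.
Proof. by rewrite /= expr0n /= addr0 sqrtr_sqr. Qed.

Lemma cabsV_nat n : cabs (n%:R^-1 : R[i]) = n%:R^-1.
Proof.
rewrite ComplexField.Normc.normcV; congr (_^-1).
by apply: (@complexI R); rewrite -normE normr_nat rmorph_nat.
Qed.

Lemma ler_cabs_sum n (u : 'I_n -> R[i]) :
  cabs (\sum_(k < n) u k) <= \sum_(k < n) cabs (u k).
Proof.
rewrite -lecR rmorph_sum /= -normE.
by rewrite (le_trans (ler_norm_sum _ _ _)).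
Qed.

Lemma ler_cabs_avg (u : nat -> R[i]) n :
  cabs (avg u n) <= avg (fun k => cabs (u k)) n.
Proof.
by rewrite ComplexField.Normc.normcM cabsV_nat ler_wpM2l ?invr_ge0// ler_cabs_sum.
Qed.

Lemma cabs_avg_le (u : nat -> R[i]) n B : 0 <= B ->
  (forall k, (k < n)%N -> cabs (u k) <= B) -> cabs (avg u n) <= B.
Proof. by move=> B0 uB; rewrite (le_trans (ler_cabs_avg _ _))// avg_le_cst. Qed.

Lemma sqr_cabs_avg_le (u : nat -> R[i]) n :
  cabs (avg u n) ^+ 2 <= avg (fun k => cabs (u k) ^+ 2) n.
Proof.
rewrite (le_trans _ (sqr_avg_le _ _))// lerXn2r ?ler_cabs_avg// nnegrE ?cabs_ge0//.
by apply: avg_ge0 => k; exact: cabs_ge0.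
Qed.

Lemma avgS_dist_le (u : nat -> R[i]) n B : 0 <= B -> (forall k, cabs (u k) <= B) ->
  cabs (avg (fun k => u k.+1) n - avg u n) <= n%:R^-1 * (2 * B).
Proof.
move=> B0 uB; rewrite avgS_sub ComplexField.Normc.normcM cabsV_nat.
rewrite ler_wpM2l ?invr_ge0// (le_trans (ler_cabsB _ _))//.
by rewrite mulr_natl mulr2n lerD.
Qed.

Lemma avg_shift_dist_le (u : nat -> R[i]) j n B :
  0 <= B -> (forall k, cabs (u k) <= B) ->
  cabs (avg (fun k => u (k + j)%N) n - avg u n) <= n%:R^-1 * (2 * B) * j%:R.
Proof.
move=> B0 uB; elim: j => [|j IH].
  rewrite (@eq_avg _ _ u); last by move=> k; rewrite addn0.
  by rewrite subrr ComplexField.Normc.normc0 mulr0.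
rewrite (le_trans (ler_cabs_dist (avg (fun k => u (k + j)%N) n) _ _))//.
rewrite -addn1 natrD mulrDr mulr1 addrC lerD//.
rewrite (_ : avg _ n = avg (fun k => (fun k => u (k + j)%N) k.+1) n); last first.
  by apply: eq_avg => k; rewrite addSnnS addn1.
exact: avgS_dist_le.
Qed.

Lemma cabs_add2_le x y : cabs (x + y) ^+ 2 <= 2 * cabs x ^+ 2 + 2 * cabs y ^+ 2.
Proof.
have := ler_cabsD x y; have := cabs_ge0 x; have := cabs_ge0 y.
have := cabs_ge0 (x + y); move: (cabs _) (cabs x) (cabs y) => s a b s0 b0 a0 sab.
have : s ^+ 2 <= (a + b) ^+ 2 by rewrite lerXn2r// nnegrE addr_ge0.
have := sqr_ge0 (a - b); rewrite sqrrB sqrrD; lra.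
Qed.

Lemma cabs_parallelogram x y : cabs (x + y) ^+ 2 + cabs (x - y) ^+ 2 =
  2 * cabs x ^+ 2 + 2 * cabs y ^+ 2.
Proof.
case: x => a b; case: y => c d /=.
by rewrite !sqr_sqrtr ?addr_ge0 ?sqr_ge0//; ring.
Qed.

Lemma Re_le_cabs x : `|complex.Re x| <= cabs x.
Proof. by rewrite -lecR -normE normc_ge_Re. Qed.

Lemma Im_le_cabs x : `|complex.Im x| <= cabs x.
Proof.
by case: x => a b /=; rewrite -[leLHS]sqrtr_sqr ler_wsqrtr// lerDr sqr_ge0.
Qed.

Lemma cabs_le_ReIm x : cabs x <= `|complex.Re x| + `|complex.Im x|.
Proof.
case: x => a b /=; have ab0 : 0 <= `|a| + `|b| by rewrite addr_ge0.
rewrite -[leRHS](ger0_norm ab0) -[leRHS]sqrtr_sqr ler_wsqrtr//.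
by rewrite sqrrD !real_normK ?num_real// lerD2r lerDl mulrn_wge0// mulr_ge0.
Qed.

End modulus.

(** * A covering lemma for sums along a sequence *)

Section covering.
Context (R : realFieldType) (l : R) (N : nat).

Let good (h : nat -> R) (k : nat) :=
  [exists n : 'I_N.+1, l * n%:R < \sum_(j < n) h (k + j)%N].

(* Greedy covering: skip the starting points that are not good, and jump over
   the witnessing block of those that are. *)
Lemma maximal_covering (L : nat) (h : nat -> R) : 0 <= l -> (forall k, 0 <= h k) ->
  l * \sum_(k < L) (good h k)%:R <= \sum_(k < L + N) h k.
Proof.
move=> l0; have [M LM] := ubnP L; elim: M => // M IH in L LM h *; move=> h0.
case: L LM => [|L] LM; first by rewrite big_ord0 mulr0 sumr_ge0.
have shiftE n k : good h (n + k)%N = good (fun k => h (n + k)%N) k.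
  by apply: eq_existsb => i; under eq_bigr do rewrite -addnA.
have [g0|g0] := boolP (good h 0); last first.
  rewrite big_ord_recl (negbTE g0) add0r addSn big_ord_recl.
  under eq_bigr do rewrite lift0 -add1n shiftE.
  rewrite ler_wpDl//; apply: (le_trans (IH L _ _ _)) => // k; exact: h0.
case/existsP: g0 => -[n nN] /=; under eq_bigr do rewrite add0n.
have sub a b : (a <= b)%N -> \sum_(k < a) h k <= \sum_(k < b) h k.
  move=> ab; rewrite -(subnKC ab) big_split_ord /= lerDl sumr_ge0//.
case: n nN => [|n] nN; first by rewrite big_ord0 mulr0 ltxx.
(* There remain [L.+1] starting points, and the block has length [n.+1 <= N]. Either it covers all
   of them, without running past [L.+1 + N], or the induction resumes right after it. *)
move=> /ltW hn; have [Ln|nL] := leqP L n.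
  apply: (@le_trans _ _ (l * n.+1%:R)).
    rewrite ler_wpM2l// (@le_trans _ _ (\sum_(k < L.+1) 1))//.
      by apply: ler_sum => i _; rewrite lern1 leq_b1.
    by rewrite sumr_const card_ord ler_nat.
  by rewrite (le_trans hn)// sub// (leq_trans (_ : _ <= N)%N)// leq_addl.
have eL : L.+1 = (n.+1 + (L - n))%N by rewrite addSn subnKC// ltnW.
have splitE (u : nat -> R) a b :
    \sum_(k < a + b) u k = \sum_(k < a) u k + \sum_(k < b) u (a + k)%N.
  by rewrite big_split_ord.
rewrite eL -addnA (splitE (fun k => (good h k)%:R)) splitE mulrDr lerD//.
  apply: le_trans hn; rewrite ler_wpM2l// (@le_trans _ _ (\sum_(k < n.+1) 1))//.
    by apply: ler_sum => i _; rewrite lern1 leq_b1.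
  by rewrite sumr_const card_ord.
under eq_bigr do rewrite shiftE.
apply: IH => //; rewrite ltnS in LM; apply: leq_trans LM.
by rewrite ltnS leq_subr.
Qed.

End covering.

(** * Bessel's inequality for finitely many frequencies *)

Section bessel.
Local Open Scope ring_scope.
Context (C : numClosedFieldType).

Lemma avg_geom_le (x : C) n : `|x| = 1 -> x != 1 ->
  `|avg (fun k => x ^+ k) n| <= n%:R^-1 * (2 / `|x - 1|).
Proof.
move=> x1 xn1; rewrite /avg normrM normfV normr_nat ler_wpM2l ?invr_ge0//.
have d0 : 0 < `|x - 1| by rewrite normr_gt0 subr_eq0.
rewrite ler_pdivlMr// -normrM mulrC -subrX1 (le_trans (ler_normB _ _))//.
by rewrite normrX x1 expr1n normr1 mulr2n.
Qed.

(** Expand the average of [|y j - z j|^2], where [z] is built from the coefficients [a i] as if it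
    were the orthogonal projection of [y] on the sequences of powers of the conjugates of the
    [lam i]. These are only almost orthonormal on [[0, H)]: the off-diagonal inner products are
    geometric averages of order [1 / H], which produce the error term. *)
Lemma bessel_avg (m : nat) (lam : 'I_m -> C) :
  (forall i, `|lam i| = 1) -> injective lam ->
  forall (H : nat) (y : nat -> C) (B : C), (0 < H)%N -> 0 <= B ->
    (forall j, `|y j| <= B) ->
  \sum_i `|avg (fun j => lam i ^+ j * y j) H| ^+ 2 <=
  B ^+ 2 * (1 + H%:R^-1 * \sum_i' \sum_(i | i != i') 2 / `|lam i * (lam i')^* - 1|).
Proof.
move=> lam1 laminj H y B H0 B0 yB.
pose a i := avg (fun j => lam i ^+ j * y j) H.
pose z j := \sum_i a i * (lam i)^* ^+ j.
pose S := \sum_i `|a i| ^+ 2.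
have H0' : (H%:R : C) != 0 by rewrite pnatr_eq0 -lt0n.
have avgJ (u : nat -> C) : avg (fun k => (u k)^*) H = (avg u H)^*.
  by rewrite /avg rmorphM fmorphV rmorph_nat rmorph_sum.
have ayz : avg (fun j => y j * (z j)^*) H = S.
  rewrite (@eq_avg _ _ (fun j => \sum_i (a i)^* * (lam i ^+ j * y j))); last first.
    move=> j; rewrite /z rmorph_sum mulr_sumr; apply: eq_bigr => i _.
    by rewrite rmorphM rmorphXn /= conjCK; ring.
  by rewrite avg_sum; apply: eq_bigr => i _; rewrite avgZ mulrC -normCK.
have Sreal : S^* = S.
  by apply/CrealP/ger0_real/sumr_ge0 => i _; rewrite exprn_ge0.
have azy : avg (fun j => z j * (y j)^*) H = S.
  rewrite -Sreal -ayz -avgJ; apply: eq_avg => j.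
  by rewrite rmorphM /= conjCK mulrC.
pose D i i' := avg (fun j => (lam i * (lam i')^*) ^+ j) H.
have azz : avg (fun j => z j * (z j)^*) H =
    \sum_i' \sum_i (a i' * (a i)^*) * D i i'.
  rewrite (@eq_avg _ _ (fun j => \sum_i' \sum_i (a i' * (a i)^*) *
      (lam i * (lam i')^*) ^+ j)); last first.
    move=> j; rewrite /z rmorph_sum mulr_suml; apply: eq_bigr => i _.
    rewrite mulr_sumr; apply: eq_bigr => i' _.
    by rewrite rmorphM rmorphXn /= conjCK exprMn; ring.
  rewrite avg_sum; apply: eq_bigr => i _; rewrite avg_sum; apply: eq_bigr => i' _.
  by rewrite avgZ.
have Dii i : D i i = 1.
  rewrite /D (@eq_avg _ _ (fun=> 1)); last first.
    by move=> j; rewrite -normCK lam1 expr1n expr1n.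
  by rewrite /avg sumr_const card_ord mulVf.
have aB i : `|a i| <= B.
  rewrite /a /avg normrM normfV normr_nat mulrC ler_pdivrMr ?ltr0n//.
  rewrite (le_trans (ler_norm_sum _ _ _))// mulr_natr.
  rewrite (@le_trans _ _ (\sum_(j < H) B))//; last by rewrite sumr_const card_ord.
  by apply: ler_sum => j _; rewrite normrM normrX lam1 expr1n mul1r.
have key : S <= avg (fun j => `|y j| ^+ 2) H +
    \sum_i' \sum_(i | i != i') `|a i'| * `|a i| * `|D i i'|.
  have : 0 <= avg (fun j => `|y j - z j| ^+ 2) H.
    by rewrite mulr_ge0 ?invr_ge0// sumr_ge0// => j _; rewrite exprn_ge0.
  rewrite (@eq_avg _ _ (fun j => `|y j| ^+ 2 - y j * (z j)^* - z j * (y j)^* +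
      z j * (z j)^*)); last first.
    by move=> j; rewrite !normCK rmorphB; ring.
  rewrite avgD !avgB ayz azy azz.
  have -> : \sum_i' \sum_i a i' * (a i)^* * D i i' =
      S + \sum_i' \sum_(i | i != i') a i' * (a i)^* * D i i'.
    rewrite -big_split; apply: eq_bigr => i _ /=.
    by rewrite (bigD1 i)//= Dii mulr1 -normCK.
  rewrite addrA subrK addrAC subr_ge0 => hS.
  have r1 : avg (fun j => `|y j| ^+ 2) H \is Num.real.
    by apply/ger0_real; rewrite mulr_ge0 ?invr_ge0// sumr_ge0// => j _.
  set T := \sum_i' \sum_(i | _) a i' * _ * _ in hS *.
  (* Complex numbers are comparable only if their difference is real, so [hS] forces [T] to be real,
     and then [T <= |T|]. *)
  have rT : T \is Num.real.
    rewrite -(addKr (avg (fun j => `|y j| ^+ 2) H) T) rpredD ?rpredN//.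
    by rewrite -(ler_real hS); apply/ger0_real/sumr_ge0 => i _; rewrite exprn_ge0.
  apply: (le_trans hS); rewrite lerD2l (le_trans (real_ler_norm rT))//.
  rewrite (le_trans (ler_norm_sum _ _ _))// ler_sum// => i _.
  rewrite (le_trans (ler_norm_sum _ _ _))// ler_sum// => i' _.
  have -> : `|a i * (a i')^* * D i' i| = `|a i| * `|a i'| * `|D i' i|.
    by rewrite normrM normrM norm_conjC.
  by [].
apply: (le_trans key); rewrite mulrDr mulr1; apply: lerD.
  rewrite /avg mulrC ler_pdivrMr ?ltr0n// mulr_natr.
  rewrite (@le_trans _ _ (\sum_(j < H) B ^+ 2))//; last by rewrite sumr_const card_ord.
  by apply: ler_sum => j _; rewrite lerXn2r// nnegrE.
rewrite mulrA mulr_sumr ler_sum// => i' _; rewrite mulr_sumr ler_sum// => i ii'.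
rewrite -[leRHS]mulrA expr2 ler_pM ?mulr_ge0// ?ler_pM//.
apply: avg_geom_le; first by rewrite normrM norm_conjC !lam1 mulr1.
apply: contra ii' => /eqP e; apply/eqP/laminj.
have e' : lam i' * (lam i')^* = 1 by rewrite -normCK lam1 expr1n.
by rewrite -[LHS]mulr1 -e' mulrCA e mulr1.
Qed.

End bessel.

(** [K] depends on the frequencies only; its contribution therefore fades as [H] grows, uniformly
    over the sequences with a given bound. *)
Lemma bessel_cabs (R : rcfType) (m : nat) (lam : 'I_m -> R[i]) :
  (forall i, cabs (lam i) = 1) -> injective lam ->
  exists2 K : R, 0 <= K & forall (H : nat) (y : nat -> R[i]) (B : R),
    (0 < H)%N -> 0 <= B -> (forall j, cabs (y j) <= B) ->
    \sum_i cabs (avg (fun j => lam i ^+ j * y j) H) ^+ 2 <=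
    B ^+ 2 * (1 + H%:R^-1 * K).
Proof.
move=> lam1 laminj.
exists (\sum_i' \sum_(i | i != i') 2 / cabs (lam i * Num.conj (lam i') - 1)).
  do 2!apply: sumr_ge0 => ? _; rewrite divr_ge0 ?cabs_ge0//.
move=> H y B H0 B0 yB.
have lam1' i : `|lam i| = 1 by rewrite normE lam1.
have yB' j : `|y j| <= B%:C by rewrite normE lecR.
have := bessel_avg lam1' laminj H0 _ yB'; rewrite lecR => /(_ B0).
set lhs := \sum_i `|_| ^+ 2; set ksum := \sum_i' _ => hle.
have lhsE : lhs = (\sum_i cabs (avg (fun j => lam i ^+ j * y j) H) ^+ 2)%:C.
  by rewrite rmorph_sum; apply: eq_bigr => i _; rewrite rmorphXn /= normE.
have ksumE : ksum =
    (\sum_i' \sum_(i | i != i') 2 / cabs (lam i * Num.conj (lam i') - 1))%:C.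
  rewrite rmorph_sum; apply: eq_bigr => i' _; rewrite rmorph_sum.
  by apply: eq_bigr => i _; rewrite fmorph_div rmorph_nat normE.
move: hle; rewrite lhsE ksumE -(rmorphXn (real_complex R)).
rewrite -(rmorph_nat (real_complex R)) -fmorphV -rmorphM.
by rewrite -(rmorph1 (real_complex R)) -rmorphD -rmorphM lecR.
Qed.

(** * The unit circle parametrized by the real line *)

Section cayley.
Context (R : realType).

(* [(1 + i t) / (1 - i t)]; it parametrizes the unit circle without [-1]. *)
Definition cayley (t : R) : R[i] :=
  ((1 - t ^+ 2) / (1 + t ^+ 2)) +i* ((2 * t) / (1 + t ^+ 2)).

Let den (t : R) : 0 < 1 + t ^+ 2.
Proof. by rewrite ltr_pwDl// sqr_ge0. Qed.

Lemma cabs_cayley t : cabs (cayley t) = 1.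
Proof.
rewrite /= -[RHS]sqrtr1; congr Num.sqrt.
by field; rewrite gt_eqF ?den.
Qed.

Lemma cayley_inj : injective cayley.
Proof.
move=> t s; rewrite /cayley => -[e1 e2].
have dt := den t; have ds := den s.
have f1 (x : R) : (1 - x ^+ 2) / (1 + x ^+ 2) = 2 / (1 + x ^+ 2) - 1.
  by field; rewrite gt_eqF ?den.
move: e1; rewrite !f1 => /(congr1 (fun x => x + 1)); rewrite !subrK => e1.
move: e2; rewrite -![2 * _ / _]mulrAC e1 => /mulfI; apply.
by rewrite mulf_neq0// ?invr_eq0 gt_eqF.
Qed.

Lemma cayley_surj (z : R[i]) : cabs z = 1 -> z != -1 -> exists t, z = cayley t.
Proof.
case: z => a b /= ab1 zn1.
have ab : a ^+ 2 + b ^+ 2 = 1.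
  by rewrite -(@sqr_sqrtr _ (_ + _)) ?addr_ge0 ?sqr_ge0// ab1 expr1n.
have a1 : a + 1 != 0.
  apply: contra zn1 => /eqP a1; have aE : a = -1 by lra.
  move: ab; rewrite aE sqrrN expr1n => /eqP; rewrite -subr_eq0 addrAC subrr add0r.
  by rewrite sqrf_eq0 => /eqP ->; rewrite eq_complex /= oppr0 !eqxx.
exists (b / (a + 1)); rewrite /cayley; apply/eqP; rewrite eq_complex /=.
have bE : b ^+ 2 = (1 - a) * (1 + a) by move: ab; lra.
have dE : 1 + (b / (a + 1)) ^+ 2 = 2 / (a + 1).
  by rewrite expr_div_n bE; field.
by rewrite dE; apply/andP; split; apply/eqP; rewrite ?expr_div_n ?bE; field.
Qed.

Lemma cayley_lip t s : cabs (cayley t - cayley s) <= 2 * `|t - s|.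
Proof.
rewrite -[leRHS]ger0_norm ?mulr_ge0// -[leRHS]sqrtr_sqr /= ler_wsqrtr//.
have dt := den t; have ds := den s.
rewrite [leLHS](_ : _ = 4 * (t - s) ^+ 2 / ((1 + t ^+ 2) * (1 + s ^+ 2))); last first.
  by field; rewrite !gt_eqF.
rewrite exprMn real_normK ?num_real// ler_pdivrMr ?mulr_gt0//.
rewrite -natrX ler_peMr//; first by rewrite mulr_ge0 ?sqr_ge0.
by rewrite mulr_ege1// lerDl sqr_ge0.
Qed.

Lemma measurable_Re_cayley : measurable_fun setT (fun t => complex.Re (cayley t)).
Proof.
apply: continuous_measurable_fun => t; rewrite /=.
apply: cvgM; last apply: cvgV; rewrite ?gt_eqF ?den//.
  by apply: cvgB; [exact: cvg_cst|exact: exprn_continuous].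
by apply: cvgD; [exact: cvg_cst|exact: exprn_continuous].
Qed.

Lemma measurable_Im_cayley : measurable_fun setT (fun t => complex.Im (cayley t)).
Proof.
apply: continuous_measurable_fun => t; rewrite /=.
apply: cvgM; last apply: cvgV; rewrite ?gt_eqF ?den//.
  by apply: cvgM; [exact: cvg_cst|exact: cvg_id].
by apply: cvgD; [exact: cvg_cst|exact: exprn_continuous].
Qed.

End cayley.

Section power_lipschitz.
Context (R : rcfType).

Lemma cabsX_lip (x y : R[i]) n : cabs x = 1 -> cabs y = 1 ->
  cabs (x ^+ n - y ^+ n) <= n%:R * cabs (x - y).
Proof.
move=> x1 y1; elim: n => [|n IH].
  by rewrite !expr0 subrr ComplexField.Normc.normc0 mul0r.
have -> : x ^+ n.+1 - y ^+ n.+1 = x * (x ^+ n - y ^+ n) + (x - y) * y ^+ n.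
  by rewrite !exprS; ring.
rewrite (le_trans (ler_cabsD _ _))// !ComplexField.Normc.normcM x1 cabsX y1.
by rewrite expr1n mul1r mulr1 -natr1 mulrDl mul1r lerD2r.
Qed.

End power_lipschitz.

(** * Approximate convergence and measurability of complex functions *)

(** As [l] may depend on [e], this is the Cauchy property. It passes through approximations without
    naming any limit; [quasi_cvg_cvgn] turns it into convergence at the very end. *)
Definition quasi_cvg (R : rcfType) (u : nat -> R[i]) : Prop :=
  forall e : R, 0 < e -> exists (l : R[i]) (N : nat),
    forall n, (N <= n)%N -> cabs (u n - l) <= e.

Lemma measurable_lt_set d (T : measurableType d) (R : realType) (f g : T -> R) :
  measurable_fun setT f -> measurable_fun setT g ->
  measurable [set w | f w < g w].
Proof.
move=> mf mg; have := measurable_fun_ltr mf mg measurableT (Y := [set true]) I.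
by rewrite setTI.
Qed.

Section complex_measurability.
Context d (T : measurableType d) (R : realType).
Implicit Types f g : T -> R[i].

Lemma cmeasurable_cst (c : R[i]) : cmeasurable (fun _ : T => c).
Proof. by split; exact: measurable_cst. Qed.

Lemma cmeasurableD f g : cmeasurable f -> cmeasurable g ->
  cmeasurable (fun w => f w + g w).
Proof.
move=> [f1 f2] [g1 g2]; split.
  rewrite (_ : (fun _ => _) = fun w => complex.Re (f w) + complex.Re (g w)).
    exact: measurable_funD.
  by apply/funext => w; case: (f w); case: (g w).
rewrite (_ : (fun _ => _) = fun w => complex.Im (f w) + complex.Im (g w)).
  exact: measurable_funD.
by apply/funext => w; case: (f w); case: (g w).
Qed.

Lemma cmeasurableM f g : cmeasurable f -> cmeasurable g ->
  cmeasurable (fun w => f w * g w).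
Proof.
move=> [f1 f2] [g1 g2]; split.
  rewrite (_ : (fun _ => _) = fun w => complex.Re (f w) * complex.Re (g w) -
      complex.Im (f w) * complex.Im (g w)).
    by apply: measurable_funB; apply: measurable_funM.
  by apply/funext => w; case: (f w); case: (g w).
rewrite (_ : (fun _ => _) = fun w => complex.Re (f w) * complex.Im (g w) +
    complex.Im (f w) * complex.Re (g w)).
  by apply: measurable_funD; apply: measurable_funM.
by apply/funext => w; case: (f w); case: (g w).
Qed.

Lemma cmeasurable_comp f (s : T -> T) : measurable_fun setT s -> cmeasurable f ->
  cmeasurable (fun w => f (s w)).
Proof.
move=> ms [f1 f2]; split; first exact: (measurableT_comp f1).
exact: (measurableT_comp f2).
Qed.

Lemma cmeasurable_real (h : T -> R) : measurable_fun setT h ->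
  cmeasurable (fun w => (h w)%:C).
Proof. by move=> mh; split => //=; exact: measurable_cst. Qed.

Lemma measurable_cabs f : cmeasurable f -> measurable_fun setT (fun w => cabs (f w)).
Proof.
move=> [f1 f2]; rewrite (_ : (fun _ => _) =
    fun w => Num.sqrt (complex.Re (f w) ^+ 2 + complex.Im (f w) ^+ 2)); last first.
  by apply/funext => w; case: (f w).
apply: (measurableT_comp (f := @Num.sqrt R)).
  by apply: continuous_measurable_fun; exact: sqrt_continuous.
by apply: measurable_funD; exact: measurable_funX.
Qed.

Lemma measurable_cabs2 f : cmeasurable f ->
  measurable_fun setT (fun w => cabs (f w) ^+ 2).
Proof. by move=> mf; apply: measurable_funX; exact: measurable_cabs. Qed.

End complex_measurability.

(** * The maximal ergodic inequality *)

Section dynamics.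
Context d (T : measurableType d) (R : realType).
Context (mu : {measure set T -> \bar R}) (tau : T -> T).
Context (tau_mp : measure_preserving mu tau).
Implicit Types (f g : T -> R[i]) (h : T -> R).

Lemma measurable_iter k : measurable_fun setT (iter k tau).
Proof.
elim: k => [|k IH]; first exact: measurable_id.
by apply: measurableT_comp => //; exact: tau_mp.1.
Qed.

Lemma ge0_integral_tau (F : T -> \bar R) :
  measurable_fun setT F -> (forall w, 0 <= F w)%E ->
  (\int[mu]_w F (tau w) = \int[mu]_w F w)%E.
Proof.
move=> mF F0; have mtau := tau_mp.1.
rewrite [RHS](@eq_measure_integral _ _ _ _ (pushforward mu tau) mu); last first.
  by move=> A mA _; rewrite -(tau_mp.2 A mA).
by rewrite [RHS](ge0_integral_pushforward mtau)// => w _; exact: F0.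
Qed.

Lemma ge0_integral_iter k (F : T -> \bar R) :
  measurable_fun setT F -> (forall w, 0 <= F w)%E ->
  (\int[mu]_w F (iter k tau w) = \int[mu]_w F w)%E.
Proof.
move=> mF F0; elim: k => // k IH; rewrite -IH.
under eq_integral do rewrite iterSr.
rewrite (ge0_integral_tau (F := fun w => F (iter k tau w)))//.
by apply: measurableT_comp => //; exact: measurable_iter.
Qed.

Lemma measurable_orbit_sum h n : measurable_fun setT h ->
  measurable_fun setT (fun w => \sum_(k < n) h (iter k tau w)).
Proof.
move=> mh; apply: measurable_sum => k.
by apply: measurableT_comp => //; exact: measurable_iter.
Qed.

Lemma integral_orbit_sum h n : measurable_fun setT h -> (forall w, 0 <= h w) ->
  (\int[mu]_w (\sum_(k < n) h (iter k tau w))%:E = n%:R%:E * \int[mu]_w (h w)%:E)%E.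
Proof.
move=> mh h0; under eq_integral do rewrite -sumEFin.
rewrite ge0_integral_sum//; last 2 first.
- move=> k; apply/measurable_EFinP; apply: measurableT_comp => //.
  exact: measurable_iter.
- by move=> k w _; rewrite lee_fin.
rewrite (eq_bigr (fun _ => \int[mu]_w (h w)%:E)%E); last first.
  move=> k _; rewrite (ge0_integral_iter _ (F := EFin \o h))//.
  exact/measurable_EFinP.
have I0 : (0 <= \int[mu]_w (h w)%:E)%E by apply: integral_ge0 => w _; rewrite lee_fin.
elim: n => [|n IH]; first by rewrite big_ord0 mul0e.
by rewrite big_ord_recr /= IH -natr1 EFinD ge0_muleDl ?mul1e ?lee_fin.
Qed.

(** The set where the maximal function of the ergodic averages of [h] exceeds [l], written without
    division; [n = 0] is never a witness. *)
Definition max_set h (l : R) : set T :=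
  [set w | exists n, l * n%:R < \sum_(k < n) h (iter k tau w)].

Lemma measurable_max_set h l : measurable_fun setT h -> measurable (max_set h l).
Proof.
move=> mh; rewrite (_ : max_set h l =
    \bigcup_n [set w | l * n%:R < \sum_(k < n) h (iter k tau w)]); last first.
  by apply/seteqP; split=> [w [n nw]|w [n _ nw]]; exists n.
apply: bigcupT_measurable => n.
apply: measurable_lt_set; first exact: measurable_cst.
exact: measurable_orbit_sum.
Qed.

(** The covering lemma along each orbit, integrated with the help of the invariance of [mu], bounds
    [L] times [l mu(E N)] by [L + N] times the integral of [h]. Letting [L] grow removes the excess
    [N]; then [N] tends to infinity by continuity from below. *)
Lemma maximal_inequality h l : measurable_fun setT h -> (forall w, 0 <= h w) ->
  0 < l -> (l%:E * mu (max_set h l) <= \int[mu]_w (h w)%:E)%E.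
Proof.
move=> mh h0 l0; set I := (\int[mu]_w _)%E.
pose E N := [set w | [exists n : 'I_N.+1, l * n%:R < \sum_(j < n) h (iter j tau w)]].
have mE N : measurable (E N).
  rewrite (_ : E N = \bigcup_(n in [set n | (n < N.+1)%N])
      [set w | l * n%:R < \sum_(k < n) h (iter k tau w)]); last first.
    apply/seteqP; split=> [w /existsP[n nw]|w [n /= nN nw]].
      by exists (val n) => //=.
    by apply/existsP; exists (Ordinal nN).
  apply: bigcup_measurable => n _.
  apply: measurable_lt_set; first exact: measurable_cst.
  exact: measurable_orbit_sum.
have I0 : (0 <= I)%E by apply: integral_ge0 => w _; rewrite lee_fin.
have bound N L : (L%:R%:E * (l%:E * mu (E N)) <= (L + N)%:R%:E * I)%E.
  have -> : (l%:E * mu (E N) = \int[mu]_w (l * \1_(E N) w)%:E)%E.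
    under eq_integral do rewrite EFinM.
    rewrite ge0_integralZl_EFin//; last 2 first.
    - exact/measurable_EFinP/measurable_indic.
    - exact: ltW.
    by rewrite integral_indic// setIT.
  rewrite -!integral_orbit_sum//; last 2 first.
  - by apply: measurable_funM => //; exact: measurable_indic.
  - by move=> w; rewrite mulr_ge0// ltW.
  apply: ge0_le_integral => //.
  - by move=> w _; rewrite lee_fin sumr_ge0// => k _; rewrite mulr_ge0// ltW.
  - apply/measurable_EFinP/(measurable_orbit_sum (h := fun w => l * \1_(E N) w)).
    by apply: measurable_funM => //; exact: measurable_indic.
  - exact/measurable_EFinP/measurable_orbit_sum.
  move=> w _; rewrite lee_fin -mulr_sumr.
  have := @maximal_covering R l N L (fun k => h (iter k tau w)) (ltW l0) (fun=> h0 _).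
  move=> cov; apply: le_trans cov; rewrite ler_wpM2l ?(ltW l0)// ler_sum// => k _.
  rewrite indicE; have [|_] := boolP (_ \in E N); last by rewrite ler0n.
  rewrite inE => /existsP[n nw]; rewrite ler_nat lt0b; apply/existsP; exists n.
  apply: (lt_le_trans nw); apply: ler_sum => j _.
  by rewrite addnC iterD.
have EI N : (l%:E * mu (E N) <= I)%E.
  move: I0 (bound N) => {bound}; case: I => [r| |] //; last by move=> *; rewrite leey.
  rewrite lee_fin => r0 bd.
  have : (l%:E * mu (E N) < +oo)%E.
    by have := bd 1%N; rewrite mul1e => /le_lt_trans; apply; rewrite -EFinM ltry.
  have : (0 <= l%:E * mu (E N))%E by rewrite mule_ge0// lee_fin ltW.
  move: bd; case: (l%:E * mu (E N))%E => // m bd m0 _; rewrite lee_fin leNgt.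
  apply/negP => rm.
  (* If [m > r], any [L] larger than [N r / (m - r)] contradicts [bd]. *)
  have := bd (Num.truncn (N%:R * r / (m - r))).+1.
  rewrite -!EFinM lee_fin natrD mulrDl -lerBlDl -mulrBr leNgt => /negP; apply.
  by rewrite -ltr_pdivrMr ?subr_gt0// truncnS_gt.
have maxE : max_set h l = \bigcup_N E N.
  apply/seteqP; split=> [w [n nw]|w [N _ /existsP[n nw]]]; last by exists n.
  by exists n => //; apply/existsP; exists ord_max.
have mmax : measurable (\bigcup_N E N) by exact: bigcupT_measurable.
have ndE : nondecreasing_seq E.
  move=> m n mn; apply/subsetPset => w /existsP[k kw]; apply/existsP.
  have mn' : (m.+1 <= n.+1)%N by rewrite ltnS.
  by exists (widen_ord mn' k).
have cvgE : (l%:E * mu (E n))%E @[n --> \oo] --> (l%:E * mu (max_set h l))%E.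
  by apply: cvgeZl => //; rewrite maxE; exact: nondecreasing_cvg_mu.
rewrite -(cvg_lim _ cvgE)//.
apply: lime_le; first by apply/cvg_ex; eexists; exact: cvgE.
by apply: nearW => n; exact: EI.
Qed.

End dynamics.

(** * Bounded square integrable functions *)

Section square_integrable.
Context d (T : measurableType d) (R : realType).
Context (mu : {measure set T -> \bar R}).
Implicit Types f g u p q : T -> R[i].

Definition sqnorm g : \bar R := (\int[mu]_w (cabs (g w) ^+ 2)%:E)%E.

(** Boundedness is kept next to square integrability so that the boundary terms [u / n] left by a
    coboundary tend to 0 at every point. *)
Record bounded_L2 g : Prop := {
  bounded_L2_measurable : cmeasurable g;
  bounded_L2_bounded : exists2 B : R, 0 <= B & forall w, cabs (g w) <= B;
  bounded_L2_sqnorm : (sqnorm g < +oo)%E }.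

Lemma sqnorm_ge0 g : (0 <= sqnorm g)%E.
Proof. by apply: integral_ge0 => w _; rewrite lee_fin sqr_ge0. Qed.

Lemma sqnormK g : bounded_L2 g -> (fine (sqnorm g))%:E = sqnorm g.
Proof. by case=> _ _ goo; rewrite fineK// ge0_fin_numE// sqnorm_ge0. Qed.

Lemma le_sqnorm_comb f g p (a b : R) : 0 <= a -> 0 <= b ->
  cmeasurable f -> cmeasurable g -> cmeasurable p ->
  (forall w, cabs (p w) ^+ 2 <= a * cabs (f w) ^+ 2 + b * cabs (g w) ^+ 2) ->
  (sqnorm p <= a%:E * sqnorm f + b%:E * sqnorm g)%E.
Proof.
move=> a0 b0 mf mg mp pfg.
have mf2 := measurable_cabs2 mf; have mg2 := measurable_cabs2 mg.
rewrite -!ge0_integralZl_EFin//; try exact/measurable_EFinP;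
  try by move=> w _; rewrite lee_fin sqr_ge0.
rewrite -ge0_integralD//; last 4 first.
- by move=> w _; rewrite -EFinM lee_fin mulr_ge0 ?sqr_ge0.
- exact/measurable_EFinP/measurable_funM.
- by move=> w _; rewrite -EFinM lee_fin mulr_ge0 ?sqr_ge0.
- exact/measurable_EFinP/measurable_funM.
apply: ge0_le_integral => //.
- by move=> w _; rewrite lee_fin sqr_ge0.
- exact/measurable_EFinP/measurable_cabs2.
- by apply/measurable_EFinP/measurable_funD; exact/measurable_funM.
- by move=> w _; rewrite -!EFinM -EFinD lee_fin.
Qed.

Lemma bounded_L2D f g : bounded_L2 f -> bounded_L2 g ->
  bounded_L2 (fun w => f w + g w).
Proof.
move=> [mf [B B0 fB] foo] [mg [C C0 gC] goo].
have mfg := cmeasurableD mf mg; split => //.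
  exists (B + C); first exact: addr_ge0.
  by move=> w; rewrite (le_trans (ler_cabsD _ _))// lerD.
have /le_lt_trans -> // : (sqnorm (fun w => (f w + g w)%R) <=
    2%:E * sqnorm f + 2%:E * sqnorm g)%E.
  by apply: le_sqnorm_comb => // w; exact: cabs_add2_le.
by rewrite lte_add_pinfty// lte_mul_pinfty ?lee_fin// ?ge0_fin_numE ?sqnorm_ge0.
Qed.

Lemma bounded_L2M (h g : T -> R[i]) : cmeasurable h ->
  (exists2 B : R, 0 <= B & forall w, cabs (h w) <= B) ->
  bounded_L2 g -> bounded_L2 (fun w => h w * g w).
Proof.
move=> mh [B B0 hB] [mg [C C0 gC] goo].
have mhg := cmeasurableM mh mg; split => //.
  exists (B * C); first exact: mulr_ge0.
  by move=> w; rewrite ComplexField.Normc.normcM ler_pM ?cabs_ge0.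
have /le_lt_trans -> // : (sqnorm (fun w => (h w * g w)%R) <=
    (B ^+ 2)%:E * sqnorm g + 0%:E * sqnorm g)%E.
  apply: le_sqnorm_comb => //; first exact: sqr_ge0.
  move=> w; rewrite ComplexField.Normc.normcM exprMn mul0r addr0 ler_wpM2r ?sqr_ge0//.
  by rewrite lerXn2r ?nnegrE ?cabs_ge0.
by rewrite mul0e adde0 lte_mul_pinfty ?lee_fin ?sqr_ge0// ?ge0_fin_numE ?sqnorm_ge0.
Qed.

Lemma bounded_L2Z c g : bounded_L2 g -> bounded_L2 (fun w => c * g w).
Proof.
by apply: bounded_L2M; [exact: cmeasurable_cst|exists (cabs c); rewrite ?cabs_ge0].
Qed.

Lemma bounded_L2B f g : bounded_L2 f -> bounded_L2 g ->
  bounded_L2 (fun w => f w - g w).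
Proof.
move=> nf /(bounded_L2Z (-1)) ng; rewrite (_ : (fun _ => _) = fun w => f w + -1 * g w).
  exact: bounded_L2D.
by apply/funext => w; rewrite mulN1r.
Qed.

Lemma bounded_L2_0 : bounded_L2 (fun _ => 0).
Proof.
split; first exact: cmeasurable_cst.
  by exists 0 => // w; rewrite ComplexField.Normc.normc0.
by rewrite /sqnorm ComplexField.Normc.normc0 expr0n integral0.
Qed.

Lemma bounded_L2_sum (F : nat -> T -> R[i]) n : (forall k, bounded_L2 (F k)) ->
  bounded_L2 (fun w => \sum_(k < n) F k w).
Proof.
move=> nF; elim: n => [|n IH].
  by under eq_fun do rewrite big_ord0; exact: bounded_L2_0.
by under eq_fun do rewrite big_ord_recr /=; exact: bounded_L2D.
Qed.

Lemma bounded_L2_avg (F : nat -> T -> R[i]) n : (forall k, bounded_L2 (F k)) ->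
  bounded_L2 (fun w => avg (F ^~ w) n).
Proof. by move=> nF; apply: bounded_L2Z; exact: bounded_L2_sum. Qed.

Lemma sqnorm_parallelogram p q : bounded_L2 p -> bounded_L2 q ->
  fine (sqnorm (fun w => p w + q w)) + fine (sqnorm (fun w => p w - q w)) =
  2 * fine (sqnorm p) + 2 * fine (sqnorm q).
Proof.
move=> np nq; have nD := bounded_L2D np nq; have nB := bounded_L2B np nq.
have m2 f : bounded_L2 f -> measurable_fun setT (fun w => (cabs (f w) ^+ 2)%:E).
  by case=> mf _ _; exact/measurable_EFinP/measurable_cabs2.
have z2 f : forall w, setT w -> (0 <= (cabs (f w) ^+ 2)%:E)%E.
  by move=> w _; rewrite lee_fin sqr_ge0.
apply: EFin_inj; rewrite !EFinD !EFinM !sqnormK// /sqnorm.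
rewrite -ge0_integralD//; [|exact: (z2 (fun w => p w + q w))|exact: m2|
  exact: (z2 (fun w => p w - q w))|exact: m2].
rewrite -!ge0_integralZl_EFin//; [|exact: z2|exact: m2|exact: z2|exact: m2].
rewrite -ge0_integralD//; last 4 first.
- by move=> w _; rewrite -EFinM lee_fin mulr_ge0 ?sqr_ge0.
- by apply/measurable_EFinP/measurable_funM => //; case: np => mf _ _; exact: measurable_cabs2.
- by move=> w _; rewrite -EFinM lee_fin mulr_ge0 ?sqr_ge0.
- by apply/measurable_EFinP/measurable_funM => //; case: nq => mf _ _; exact: measurable_cabs2.
by apply: eq_integral => w _; rewrite -!EFinM -!EFinD cabs_parallelogram.
Qed.

Lemma sqnormZ c g : bounded_L2 g ->
  fine (sqnorm (fun w => c * g w)) = cabs c ^+ 2 * fine (sqnorm g).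
Proof.
move=> ng; apply: EFin_inj; rewrite EFinM !sqnormK//; last exact: bounded_L2Z.
rewrite -ge0_integralZl_EFin//; last 3 first.
- by move=> w _; rewrite lee_fin sqr_ge0.
- by case: ng => mg _ _; exact/measurable_EFinP/measurable_cabs2.
- exact: sqr_ge0.
by apply: eq_integral => w _; rewrite -EFinM ComplexField.Normc.normcM exprMn.
Qed.

End square_integrable.

(** * The pointwise ergodic theorem with an invariant twist *)

Section twisted_ergodic_theorem.
Context d (T : measurableType d) (R : realType).
Context (mu : {measure set T -> \bar R}) (tau : T -> T).
Context (tau_mp : measure_preserving mu tau).
Implicit Types f g u p q : T -> R[i].

Lemma bounded_L2_tau g : bounded_L2 mu g -> bounded_L2 mu (fun w => g (tau w)).
Proof.
case=> mg [B B0 gB] goo; split; [|by exists B|].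
  by apply: cmeasurable_comp => //; exact: tau_mp.1.
rewrite /sqnorm (ge0_integral_tau tau_mp (F := fun w => (cabs (g w) ^+ 2)%:E))//.
  exact/measurable_EFinP/measurable_cabs2.
by move=> w; rewrite lee_fin sqr_ge0.
Qed.

Lemma bounded_L2_iter g k : bounded_L2 mu g -> bounded_L2 mu (fun w => g (iter k tau w)).
Proof.
move=> ng; elim: k => // k IH.
rewrite (_ : (fun w => _) = fun w => g (iter k tau (tau w))).
  exact: (bounded_L2_tau IH).
by apply/funext => w; rewrite iterSr.
Qed.

Context (phi : T -> R[i]) (mphi : cmeasurable phi).
Context (phi1 : forall w, cabs (phi w) = 1) (phi_inv : forall w, phi (tau w) = phi w).

Let V g w := phi w * g (tau w).
Let A g n w := avg (fun k => phi w ^+ k * g (iter k tau w)) n.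
Let E g := fine (sqnorm mu g).

Let bounded_L2_V g : bounded_L2 mu g -> bounded_L2 mu (V g).
Proof.
move=> ng; apply: bounded_L2M => //; first by exists 1 => // w; rewrite phi1.
exact: bounded_L2_tau.
Qed.

Let E_V g : bounded_L2 mu g -> E (V g) = E g.
Proof.
move=> [mg _ _]; congr fine; rewrite /sqnorm.
under eq_integral do rewrite ComplexField.Normc.normcM phi1 mul1r.
rewrite (ge0_integral_tau tau_mp (F := fun w => (cabs (g w) ^+ 2)%:E))//.
  exact/measurable_EFinP/measurable_cabs2.
by move=> w; rewrite lee_fin sqr_ge0.
Qed.

Let phi_iter k w : phi (iter k tau w) = phi w.
Proof. by elim: k => //= k <-; rewrite phi_inv. Qed.

(** As [phi] is constant along orbits, [V] acts as a shift on the sequence [v], and the sum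
    telescopes. *)
Let A_coboundary u n w :
  A (fun w => u w - V u w) n w = n%:R^-1 * (u w - phi w ^+ n * u (iter n tau w)).
Proof.
pose v k := phi w ^+ k * u (iter k tau w).
rewrite /A (@eq_avg _ _ (fun k => v k - v k.+1)); last first.
  by move=> k; rewrite /V mulrBr phi_iter mulrA -exprSr.
by rewrite avgB -opprB avgS_sub -mulrN opprB /v expr0 mul1r.
Qed.

Let AB p q n w : A (fun w => p w - q w) n w = A p n w - A q n w.
Proof. by rewrite /A -avgB; apply: eq_avg => k; rewrite mulrBr. Qed.

Let A1 p w : A p 1 w = p w.
Proof. by rewrite /A avg1 expr0 mul1r. Qed.

(** The maximal inequality will be applied to [|u|^2], whence the threshold [4^-1 ^+ j], the square
    of [2^-1 ^+ j]. Comparing mean and quadratic mean brings this back to averages of [u]. *)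
Let A_le_of_notin_max_set u j w :
  ~ max_set tau (fun w => cabs (u w) ^+ 2) (4^-1 ^+ j) w ->
  (forall n, cabs (A u n w) <= 2^-1 ^+ j) /\
  (forall n, \sum_(k < n) cabs (u (iter k tau w)) <= n%:R * 2^-1 ^+ j).
Proof.
move=> notM; have h0 : 0 <= 2^-1 ^+ j :> R by rewrite exprn_ge0.
have avg2 n : avg (fun k => cabs (u (iter k tau w)) ^+ 2) n <= (2^-1 ^+ j) ^+ 2.
  case: n => [|n]; first by rewrite /avg big_ord0 mulr0 sqr_ge0.
  rewrite /avg mulrC ler_pdivrMr// leNgt; apply/negP => lt; apply: notM; exists n.+1.
  rewrite (_ : 4^-1 = 2^-1 ^+ 2 :> R); last by rewrite exprVn -natrX.
  by rewrite exprAC.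
split=> n.
  rewrite -(@ler_pXn2r _ 2) ?nnegrE ?cabs_ge0// (le_trans _ (avg2 n))//.
  rewrite (le_trans (sqr_cabs_avg_le _ _))//; apply: ler_avg => k.
  by rewrite ComplexField.Normc.normcM cabsX phi1 expr1n mul1r.
case: n => [|n]; first by rewrite big_ord0 mul0r.
rewrite mulrC -ler_pdivrMr// mulrC -[leLHS]/(avg (fun k => cabs (u (iter k tau w))) n.+1).
rewrite -(@ler_pXn2r _ 2) ?nnegrE//; last by apply: avg_ge0 => k; exact: cabs_ge0.
by rewrite (le_trans (sqr_avg_le _ _)).
Qed.

(** Telescoping along the orbit: a function that is almost [V]-invariant there is almost constant
    once twisted by the powers of [phi]. *)
Let orbit_dist_le p k w : cabs (phi w ^+ k * p (iter k tau w) - p w) <=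
  \sum_(i < k) cabs (p (iter i tau w) - V p (iter i tau w)).
Proof.
elim: k => [|k IH].
  by rewrite expr0 mul1r subrr ComplexField.Normc.normc0 big_ord0.
rewrite big_ord_recr /= addrC.
rewrite (le_trans (ler_cabs_dist (phi w ^+ k * p (iter k tau w)) _ _))// lerD//.
rewrite exprSr -mulrA -mulrBr ComplexField.Normc.normcM cabsX phi1 expr1n mul1r.
by rewrite cabsB /V phi_iter.
Qed.

(* [C] is the affine space [g + (1 - V) u], [u] bounded in L2; as it is stable under [V] and
   midpoints, the parallelogram identity makes near-minimizers [p j] of the norm
   close to each other and almost [V]-invariant. *)
Lemma twisted_ergodic_theorem g : bounded_L2 mu g ->
  {ae mu, forall w, quasi_cvg (fun n => avg (fun k => phi w ^+ k * g (iter k tau w)) n)}.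
Proof.
move=> ng.
pose C p := exists2 u, bounded_L2 mu u & p = (fun w => g w - (u w - V u w)).
have nC p : C p -> bounded_L2 mu p.
  move=> [u nu ->]; apply: bounded_L2B => //; apply: bounded_L2B => //.
  exact: bounded_L2_V.
have Cg : C g.
  exists (fun=> 0); first exact: bounded_L2_0.
  by apply/funext => w; rewrite /V mulr0 !subr0.
have CV p : C p -> C (V p).
  (* [V p = p - (p - V p)], so [V p] differs from [g] by the coboundary of [u + p]. *)
  move=> Cp; have [u nu pE] := Cp; exists (fun w => u w + p w).
    by apply: bounded_L2D => //; exact: nC.
  apply/funext => w; rewrite {1}/V [in RHS]pE /V.
  by rewrite pE /V; ring.
have Cmid p q : C p -> C q -> C (fun w => 2^-1 * (p w + q w)).
  move=> [u nu ->] [v nv ->]; exists (fun w => 2^-1 * (u w + v w)).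
    by apply: bounded_L2Z; exact: bounded_L2D.
  by apply/funext => w; rewrite /V; field.
pose m := inf [set E p | p in C].
have hinf : has_inf [set E p | p in C].
  split; first by exists (E g), g.
  by exists 0 => _ [p _ <-]; rewrite fine_ge0// sqnorm_ge0.
have mE p : C p -> m <= E p by move=> Cp; apply: ge_inf; [exact: hinf.2|exists p].
have Edist p q e e' : C p -> C q -> E p < m + e -> E q < m + e' ->
    E (fun w => p w - q w) <= 2 * e + 2 * e'.
  move=> Cp Cq pe qe; have := sqnorm_parallelogram (nC _ Cp) (nC _ Cq).
  have := mE _ (Cmid _ _ Cp Cq).
  rewrite [E _]sqnormZ; last by apply: bounded_L2D; exact: nC.
  rewrite cabsV_nat exprVn -/(E _) -/(E _) -/(E p) -/(E q); lra.
(* The precision [8^-1 ^+ j], divided by the threshold [4^-1 ^+ j] of the maximal inequality, leaves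
   the summable [2^-1 ^+ j] that Borel-Cantelli requires. *)
have e8 j : 0 < 8^-1 ^+ j :> R by rewrite exprn_gt0.
have /choice[p pP] j : exists p, C p /\ E p < m + 8^-1 ^+ j.
  have [_ [p Cp <-] pm] := inf_adherent (e8 j) hinf.
  by exists p.
pose sq u := fun w => cabs (u w) ^+ 2 : R.
pose D1 j w := p j w - p j.+1 w; pose D2 j w := p j w - V (p j) w.
pose F j := max_set tau (sq (D1 j)) (4^-1 ^+ j) `|` max_set tau (sq (D2 j)) (4^-1 ^+ j).
have nD1 j : bounded_L2 mu (D1 j).
  exact: (bounded_L2B (nC _ (pP j).1) (nC _ (pP j.+1).1)).
have nD2 j : bounded_L2 mu (D2 j).
  exact: (bounded_L2B (nC _ (pP j).1) (bounded_L2_V (nC _ (pP j).1))).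
have msq u : bounded_L2 mu u -> measurable_fun setT (sq u).
  by case=> mu' _ _; exact: measurable_cabs2.
have mF j : measurable (F j).
  by apply: measurableU; apply: (measurable_max_set tau_mp); exact: msq.
have e4 j : 0 < 4^-1 ^+ j :> R by rewrite exprn_gt0.
have bound1 j u : bounded_L2 mu u -> E u <= 4 * 8^-1 ^+ j ->
    (mu (max_set tau (sq u) (4^-1 ^+ j)) <= (4 * 2^-1 ^+ j)%:E)%E.
  move=> nu uj.
  have := maximal_inequality tau_mp (msq _ nu) (fun=> sqr_ge0 _) (e4 j).
  rewrite -[X in (_ <= X)%E]/(sqnorm mu u) -(sqnormK nu) -/(E u) => h.
  rewrite -(@lee_pmul2l _ (4^-1 ^+ j)%:E)//.
  rewrite (le_trans h)// -EFinM lee_fin mulrCA -exprMn.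
  by rewrite (_ : 4^-1 * 2^-1 = 8^-1 :> R)//; field.
have muF j : (mu (F j) <= (8 * 2^-1 ^+ j)%:E)%E.
  have [Cj pj] := pP j; have [Cj1 pj1] := pP j.+1.
  have e8j : 8^-1 ^+ j.+1 <= 8^-1 ^+ j :> R.
    by rewrite exprS ler_piMl ?exprn_ge0// invf_le1// ler1n.
  rewrite (le_trans (measureU2 _ _ _))//; try by apply: (measurable_max_set tau_mp); exact: msq.
  rewrite (_ : 8 * _ = 4 * 2^-1 ^+ j + 4 * 2^-1 ^+ j); last by ring.
  rewrite EFinD leeD//; apply: bound1 => //.
    by rewrite (le_trans (Edist _ _ _ _ Cj Cj1 pj pj1))//; move: e8j; lra.
  have Vj : E (V (p j)) < m + 8^-1 ^+ j by rewrite E_V//; exact: nC.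
  by rewrite (le_trans (Edist _ _ _ _ Cj (CV _ Cj) pj Vj))//; lra.
have F0 : mu (lim_sup_set F) = 0%E.
  apply: lim_sup_set_cvg0 => //.
  (* 16 is the sum of the series of the bounds [8 * 2^-1 ^+ j]. *)
  apply: (@le_lt_trans _ _ 16%:E); last exact: ltry.
  apply: (le_trans _ (@epsilon_trick0 R 16 xpredT (ler0n _ _))).
  apply: lee_nneseries => // j _; rewrite (le_trans (muF j))// lee_fin.
  by rewrite natrX exprS exprVn invfM; lra.
exists (lim_sup_set F); split => //.
  by apply: bigcapT_measurable => j; apply: bigcup_measurable.
move=> w /= nq; apply: contrapT => wF; apply: nq.
have [J JF] : exists J, forall j, (J <= j)%N -> ~ F j w.
  apply: contrapT => /forallNP h; apply: wF => J _ /=.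
  have /existsNP[j /not_implyP[Jj /contrapT Fj]] := h J.
  by exists j.
have notF1 j : (J <= j)%N -> ~ max_set tau (sq (D1 j)) (4^-1 ^+ j) w.
  by move=> Jj h; apply: (JF _ Jj); left.
have notF2 j : (J <= j)%N -> ~ max_set tau (sq (D2 j)) (4^-1 ^+ j) w.
  by move=> Jj h; apply: (JF _ Jj); right.
(* Consecutive averages differ by at most [2^-1 ^+ j] from [J] on; the bound is the resulting
   geometric sum in closed form. *)
have Ap i k n : (J <= i)%N ->
    cabs (A (p i) n w - A (p (i + k)%N) n w) <= 2 * 2^-1 ^+ i - 2 * 2^-1 ^+ (i + k).
  move=> Ji; elim: k => [|k IH]; first by rewrite addn0 !subrr ComplexField.Normc.normc0.
  rewrite (le_trans (ler_cabs_dist (A (p (i + k)%N) n w) _ _))//.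
  have Jik : (J <= i + k)%N by rewrite (leq_trans Ji)// leq_addr.
  have := (A_le_of_notin_max_set (notF1 _ Jik)).1 n; rewrite AB -addnS.
  by move: IH; rewrite addnS exprS; lra.
have Ap0 j n : (J <= j)%N -> (0 < n)%N -> cabs (A (p j) n w - p j w) <= n%:R * 2^-1 ^+ j.
  move=> Jj n0.
  have -> : A (p j) n w - p j w =
      avg (fun k => phi w ^+ k * p j (iter k tau w) - p j w) n.
    by rewrite avgB avg_cst.
  apply: cabs_avg_le => [|k kn]; first by rewrite mulr_ge0// exprn_ge0.
  rewrite (le_trans (orbit_dist_le _ _ _))//.
  rewrite (le_trans ((A_le_of_notin_max_set (notF2 _ Jj)).2 k))//.
  by rewrite ler_wpM2r ?exprn_ge0// ler_nat ltnW.
(* The bound [Ap0] grows with [n]. Passing to [p (i + k)], with [k] chosen after [n], makes it as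
   small as desired; the price is [Ap] used twice, at time [n] and at time 1, where the average is
   the function itself. *)
have Api i n : (J <= i)%N -> (0 < n)%N -> cabs (A (p i) n w - p i w) <= 4 * 2^-1 ^+ i.
  move=> Ji n0; apply/ler_addgt0Pr => e e0.
  have [k kn] := @exists_half_pow_le R n%:R e (ler0n _ _) e0.
  have h1 := Ap i k n Ji; have h2 := Ap i k 1%N Ji; rewrite !A1 in h2.
  have Jik : (J <= i + k)%N by rewrite (leq_trans Ji)// leq_addr.
  have h3 := Ap0 _ _ Jik n0.
  have h4 : n%:R * 2^-1 ^+ (i + k) <= e.
    apply: le_trans kn; rewrite ler_wpM2l// exprD ler_piMl ?exprn_ge0//.
    by rewrite exprn_ile1// invf_le1// ler1n.
  have t1 := ler_cabs_dist (A (p (i + k)%N) n w) (A (p i) n w) (p i w).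
  have t2 := ler_cabs_dist (p (i + k)%N w) (A (p (i + k)%N) n w) (p i w).
  rewrite cabsB in h2; have : 0 <= 2^-1 ^+ (i + k) :> R by rewrite exprn_ge0.
  by move: h1 h2 h3 h4 t1 t2; lra.
move=> e e0; have e2 : 0 < e / 2 by rewrite divr_gt0.
have [k ke] : exists k, 4 * 2^-1 ^+ k <= e / 2 :> R.
  exact: exists_half_pow_le.
pose i := (J + k)%N.
have [[u [_ [B B0 uB] _] pE] _] := pP i.
have [N NB] := @exists_inv_nat_le R (2 * B) (e / 2) (mulr_ge0 (ler0n _ _) B0) e2.
(* The value [p i w] is the approximate limit: the averages of [p i] stay close to it by [Api], and
   [g - p i] is the coboundary of a bounded function, with averages of order [1 / n]. *)
exists (p i w), N.+1 => n Nn; have n0 : (0 < n)%N by apply: leq_trans Nn.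
rewrite -[avg _ n]/(A g n w).
have h1 : cabs (A (p i) n w - p i w) <= e / 2.
  rewrite (le_trans (Api _ _ _ n0)) ?leq_addr// (le_trans _ ke)// ler_wpM2l//.
  by rewrite exprD ler_piMl ?exprn_ge0// exprn_ile1// invf_le1// ler1n.
have h2 : cabs (A g n w - A (p i) n w) <= e / 2.
  rewrite -AB (_ : (fun _ => _) = fun w => u w - V u w); last first.
    by apply/funext => x; rewrite pE subKr.
  rewrite A_coboundary ComplexField.Normc.normcM cabsV_nat (le_trans _ (NB n (ltnW Nn)))//.
  rewrite ler_wpM2l ?invr_ge0// (le_trans (ler_cabsB _ _))// mulr_natl mulr2n lerD//.
  by rewrite ComplexField.Normc.normcM cabsX phi1 expr1n mul1r.
by rewrite (le_trans (ler_cabs_dist (A (p i) n w) _ _))//; move: h1 h2; lra.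
Qed.

End twisted_ergodic_theorem.

(** * Window averages, van der Corput's inequality and peaks *)

Section window_averages.
Context (R : realType).
Implicit Types (l : R[i]) (y : nat -> R[i]).

Definition window l (H : nat) y : R := cabs (avg (fun j => l ^+ j * y j) H) ^+ 2.

(** When the correlations of [y] exist, the limit in [N] is the integral of a Fejér kernel of order
    [H] against the spectral measure of [y], which tends to the mass of an atom as [H] grows. *)
Definition mean_window l (H N : nat) y : R :=
  avg (fun n => window l H (fun j => y (j + n)%N)) N.

Lemma window_ge0 l H y : 0 <= window l H y.
Proof. exact: sqr_ge0. Qed.

Lemma mean_window_ge0 l H N y : 0 <= mean_window l H N y.
Proof. by apply: avg_ge0 => k; exact: window_ge0. Qed.

Lemma avg_exchange (K : fieldType) (u : nat -> nat -> K) N H :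
  avg (fun n => avg (u n) H) N = avg (fun j => avg (u ^~ j) N) H.
Proof.
by rewrite /avg -!mulr_sumr exchange_big /= mulrCA.
Qed.

(* Van der Corput: up to boundary terms, the average over [0, N) is the average
   over n of the averages over the windows [n, n + H). *)
Lemma van_der_corput l y (B s : R) H N : cabs l = 1 -> (0 < H)%N ->
  0 <= B -> (forall k, cabs (y k) <= B) -> 0 <= s -> mean_window l H N y <= s ^+ 2 ->
  cabs (avg (fun k => l ^+ k * y k) N) <= s + N%:R^-1 * (2 * B) * H%:R.
Proof.
move=> l1 H0 B0 yB s0 Ws; pose u k := l ^+ k * y k.
have uB k : cabs (u k) <= B by rewrite ComplexField.Normc.normcM cabsX l1 expr1n mul1r.
pose v := avg (fun n => l ^+ n * avg (fun j => l ^+ j * y (j + n)%N) H) N.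
have vE : v = avg (fun j => avg (fun n => u (n + j)%N) N) H.
  rewrite -avg_exchange; apply: eq_avg => n; rewrite -avgZ; apply: eq_avg => j.
  by rewrite mulrA -exprD addnC [in RHS]/u addnC.
have vs : cabs v <= s.
  rewrite -(@ler_pXn2r _ 2) ?nnegrE ?cabs_ge0// (le_trans (sqr_cabs_avg_le _ _))//.
  rewrite (le_trans _ Ws)//; apply: ler_avg => n.
  by rewrite ComplexField.Normc.normcM cabsX l1 expr1n mul1r.
have uv : cabs (avg u N - v) <= N%:R^-1 * (2 * B) * H%:R.
  rewrite vE -(avg_cst (avg u N) H0) -avgB; apply: cabs_avg_le.
    by rewrite !mulr_ge0 ?invr_ge0.
  move=> j jH; rewrite cabsB (le_trans (avg_shift_dist_le _ _ B0 uB))//.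
  by rewrite ler_wpM2l ?mulr_ge0 ?invr_ge0// ler_nat ltnW.
have := ler_cabsD (avg u N - v) v; rewrite subrK => /le_trans; apply.
by rewrite addrC lerD.
Qed.

Section bounded_sequence.
Context (B : R) (B0 : 0 <= B) (y : nat -> R[i]) (yB : forall k, cabs (y k) <= B).

Let avg_cabs_le l H n : cabs l = 1 ->
  cabs (avg (fun j => l ^+ j * y (j + n)%N) H) <= B.
Proof.
move=> l1; apply: cabs_avg_le => // k _.
by rewrite ComplexField.Normc.normcM cabsX l1 expr1n mul1r.
Qed.

Let dist_sqr_le (a b c : R) : 0 <= a -> 0 <= b -> a <= B -> b <= B ->
  `|a - b| <= c -> `|a ^+ 2 - b ^+ 2| <= c * (2 * B).
Proof.
move=> a0 b0 aB bB abc; rewrite subr_sqr normrM ler_pM// ger0_norm ?addr_ge0//.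
by have := lerD aB bB; lra.
Qed.

Let window_lip t s H n : `|window (cayley t) H (fun j => y (j + n)%N) -
    window (cayley s) H (fun j => y (j + n)%N)|
  <= 4 * B ^+ 2 * H%:R * `|t - s|.
Proof.
apply: (@le_trans _ _ (B * (H%:R * (2 * `|t - s|)) * (2 * B))); last first.
  by rewrite le_eqVlt; apply/orP; left; apply/eqP; ring.
apply: dist_sqr_le; rewrite ?cabs_ge0 ?avg_cabs_le ?cabs_cayley//.
rewrite (le_trans (ler_cabs_distl _ _))// -avgB; apply: cabs_avg_le.
  by rewrite !mulr_ge0.
move=> j jH; rewrite -mulrBl ComplexField.Normc.normcM mulrC ler_pM ?cabs_ge0//.
rewrite (le_trans (cabsX_lip _ _ _)) ?cabs_cayley// ler_pM ?cabs_ge0//.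
  by rewrite ler_nat ltnW.
exact: cayley_lip.
Qed.

(** The constant is independent of [N], so that properties of all large [N] can be transferred
    between rational and real parameters. *)
Lemma mean_window_lip t s H N :
  `|mean_window (cayley t) H N y - mean_window (cayley s) H N y|
  <= 4 * B ^+ 2 * H%:R * `|t - s|.
Proof.
rewrite /mean_window -avgB /avg normrM ger0_norm ?invr_ge0//.
rewrite (le_trans (ler_wpM2l _ (ler_norm_sum _ _ _))) ?invr_ge0//.
apply: (avg_le_cst (u := fun n => `|window (cayley t) H (fun j => y (j + n)%N) -
  window (cayley s) H (fun j => y (j + n)%N)|)) => [|k _]; last exact: window_lip.
by rewrite !mulr_ge0 ?sqr_ge0.
Qed.

Lemma mean_window_shift l H N : cabs l = 1 ->
  `|mean_window l H N (fun j => y j.+1) - mean_window l H N y| <= N%:R^-1 * B ^+ 2.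
Proof.
move=> l1; pose u n := window l H (fun j => y (j + n)%N).
have -> : mean_window l H N (fun j => y j.+1) = avg (fun n => u n.+1) N.
  by apply: eq_avg => n; rewrite /u /window; congr (cabs _ ^+ 2);
     apply: eq_avg => j; rewrite addnS.
rewrite avgS_sub normrM ger0_norm ?invr_ge0// ler_wpM2l ?invr_ge0//.
have uB n : 0 <= u n <= B ^+ 2.
  rewrite window_ge0 /= lerXn2r ?nnegrE ?cabs_ge0//; exact: avg_cabs_le.
by have /andP[? ?] := uB N; have /andP[? ?] := uB 0; rewrite ler_norml; lra.
Qed.

End bounded_sequence.

Definition frequently_above l H (a : R) y : Prop :=
  forall N0, exists2 N, (N0 <= N)%N & a < mean_window l H N y.

(** For every nonempty window, the upper limit of [mean_window] in [N] is at least [d]. Stating this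
    through all [a < d] leaves room to absorb small perturbations. *)
Definition peak (d : R) y l : Prop :=
  forall H a, a < d -> frequently_above l H.+1 a y.

(** Restricted to rational parameters, this is a countable family of conditions, as needed almost
    everywhere; [quasi_cvg_mean_window] extends it to real ones. *)
Definition regular y : Prop :=
  forall (r : rat) H, quasi_cvg (fun N => (mean_window (cayley (ratr r)) H N y)%:C).

Lemma frequently_above_near l l' H a a' y z c C : 0 <= C ->
  (forall N, `|mean_window l' H N z - mean_window l H N y| <= c + N%:R^-1 * C) ->
  a' + c < a -> frequently_above l H a y -> frequently_above l' H a' z.
Proof.
move=> C0 yz aa fy N0; have e0 : 0 < (a - (a' + c)) by rewrite subr_gt0.
have [N1 hN1] := exists_inv_nat_le C0 e0.
have [N] := fy (maxn N0 N1); rewrite geq_max => /andP[N0N N1N] aN.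
exists N => //; have := hN1 N N1N; have := yz N; rewrite ler_distl => /andP[+ _].
by move: aN; lra.
Qed.

(** A shift of [y] changes [mean_window] by [O(1 / N)], which the gap between [a] and [d] absorbs.
    This is the source of the [tau]-invariance of the peaks. *)
Lemma peak_shift B d y l : 0 <= B -> (forall k, cabs (y k) <= B) -> cabs l = 1 ->
  peak d (fun j => y j.+1) l <-> peak d y l.
Proof.
move=> B0 yB l1; have B20 : 0 <= B ^+ 2 by exact: sqr_ge0.
have dist H N := mean_window_shift B0 yB H N l1.
by split=> h H a ad; (have /h fa : (a + d) / 2 < d by lra);
  apply: (frequently_above_near (c := 0) B20 _ _ (fa H)) => [N|]; rewrite ?add0r;
  [rewrite distrC; exact: dist| lra|exact: dist|lra].
Qed.

(** For some window length, [mean_window] is eventually at most some [a < d]. Van der Corput gives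
    the bound [Num.sqrt a] plus a boundary term, which fits into the gap up to [Num.sqrt d] for
    large [n]. *)
Lemma not_peak B d y l : 0 <= B -> (forall k, cabs (y k) <= B) -> cabs l = 1 ->
  ~ peak d y l ->
  exists N, forall n, (N <= n)%N -> cabs (avg (fun k => l ^+ k * y k) n) <= Num.sqrt d.
Proof.
move=> B0 yB l1 /existsNP[H /existsNP[a /not_implyP[ad /existsNP[N0 hN0]]]].
have Wa n : (N0 <= n)%N -> mean_window l H.+1 n y <= a.
  by move=> nN; rewrite leNgt; apply/negP => an; apply: hN0; exists n.
have a0 : 0 <= a by rewrite (le_trans _ (Wa N0 _))// mean_window_ge0.
have sad : Num.sqrt a < Num.sqrt d by rewrite ltr_sqrt// (le_lt_trans a0).
have [N1 hN1] : exists N, forall n, (N <= n)%N ->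
    n%:R^-1 * (2 * B * H.+1%:R) <= Num.sqrt d - Num.sqrt a.
  by apply: exists_inv_nat_le; rewrite ?subr_gt0// !mulr_ge0.
exists (maxn N0 N1) => n; rewrite geq_max => /andP[N0n N1n].
have := @van_der_corput l y B (Num.sqrt a) H.+1 n l1 isT B0 yB (sqrtr_ge0 _).
rewrite sqr_sqrtr// => /(_ (Wa _ N0n)); have := hN1 n N1n; rewrite mulrA; lra.
Qed.

Lemma quasi_cvg_mean_window B y t H : 0 <= B -> (forall k, cabs (y k) <= B) ->
  regular y -> quasi_cvg (fun N => (mean_window (cayley t) H N y)%:C).
Proof.
move=> B0 yB ry e e0.
have [L L0 LB] : exists2 L, 0 < L & 4 * B ^+ 2 * H%:R <= L.
  exists (4 * B ^+ 2 * H%:R + 1); last by rewrite lerDl.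
  by rewrite ltr_wpDl// !mulr_ge0// sqr_ge0.
have e2 : 0 < e / 2 by rewrite divr_gt0.
have tL : t < t + e / 2 / L by rewrite ltrDl divr_gt0.
have [r] := rat_in_itvoo tL.
rewrite in_itv /= => /andP[tr rt]; have [z [N hN]] := ry r H _ e2.
exists z, N => n Nn; have := hN n Nn.
have := mean_window_lip B0 yB t (ratr r) H n.
move: (mean_window _ _ _ _) (mean_window _ _ _ _) => W W' WW hW'.
have {}WW : `|W' - W| <= e / 2.
  rewrite (le_trans WW)// (@le_trans _ _ (L * (ratr r - t)))//.
    by rewrite distrC gtr0_norm ?subr_gt0// ler_wpM2r// subr_ge0 ltW.
  by rewrite mulrC -ler_pdivlMr// lerBlDl ltW.
rewrite (le_trans (ler_cabs_dist W%:C _ _))// -rmorphB cabs_real.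
by move: WW hW'; lra.
Qed.

(** For [m] distinct peaks, regularity turns frequently into eventually, so at a common large [N]
    the values of [mean_window] add up to at least [m d / 4]. Bessel bounds the same sum by [2 B^2]
    once [H] exceeds the constant [K]; hence [m <= 8 B^2 / d]. *)
Lemma finite_peaks B d y : 0 <= B -> (forall k, cabs (y k) <= B) -> regular y ->
  0 < d -> finite_set [set t | peak d y (cayley t)].
Proof.
move=> B0 yB ry d0; apply: contrapT => infP.
pose M := (Num.truncn (8 * B ^+ 2 / d)).+1.
have [C CP MC] := infinite_set_fset M infP.
pose s := finmap.enum_fset C; pose m := size s.
pose t (i : 'I_m) := nth 0 s i.
have us : uniq s by exact: finmap.fset_uniq.
have tP i : peak d y (cayley (t i)).
  by apply: CP; rewrite /= /t; apply: mem_nth.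
have lam_inj : injective (fun i => cayley (t i)).
  move=> i j /cayley_inj /eqP; rewrite nth_uniq// => /eqP ij; exact: val_inj.
have [K K0 bes] := bessel_cabs (fun i => cabs_cayley (t i)) lam_inj.
have [H0 hH] := @exists_inv_nat_le R K 1 K0 ltr01.
pose H := H0.+1.
(* Some late value exceeds [d / 2], and all late values lie within [d / 8] of the same [z], hence
   within [d / 4] of each other. *)
have ev i : exists N, forall n, (N <= n)%N -> d / 4 <= mean_window (cayley (t i)) H n y.
  have d8 : 0 < d / 8 by rewrite divr_gt0.
  have [z [N hN]] := quasi_cvg_mean_window (t i) H B0 yB ry d8.
  have d2 : d / 2 < d by lra.
  have [N1 NN1 dN1] := tP i H0 _ d2 N.
  exists N => n Nn; have h1 := hN _ NN1; have h2 := hN _ Nn.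
  have := ler_cabs_dist z (mean_window (cayley (t i)) H N1 y)%:C
    (mean_window (cayley (t i)) H n y)%:C.
  rewrite (cabsB z) -rmorphB cabs_real => h3.
  have := ler_norm (mean_window (cayley (t i)) H N1 y - mean_window (cayley (t i)) H n y).
  by move: h1 h2 h3 dN1; rewrite -/H; lra.
have [N hN] := choice ev; pose n := (\max_i N i).+1.
have nN i : (N i <= n)%N by rewrite ltnW// ltnS; exact: (leq_bigmax i).
have lower : m%:R * (d / 4) <= \sum_i mean_window (cayley (t i)) H n y.
  rewrite (@le_trans _ _ (\sum_(i < m) d / 4))//.
    by rewrite sumr_const card_ord mulr_natl.
  by apply: ler_sum => i _; exact: hN.
have upper : \sum_i mean_window (cayley (t i)) H n y <= B ^+ 2 * 2.
  rewrite -avg_sum; apply: avg_le_cst => [|k _]; first by rewrite mulr_ge0// sqr_ge0.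
  rewrite (le_trans (bes H _ B isT B0 _))// ler_wpM2l ?sqr_ge0//.
  by have := hH H (leqnSn _); lra.
have Mm : M%:R <= m%:R :> R by rewrite ler_nat.
have := truncnS_gt (8 * B ^+ 2 / d); rewrite -/M ltNge => /negP; apply.
rewrite ler_pdivlMr//; have := ler_wpM2r (ltW d0) Mm.
by move: lower upper; lra.
Qed.

(* Compactness of [[p, q]] turns the uncountable existential into a countable
   condition. *)
Lemma exists_peakP B d y (p q : rat) : 0 <= B -> (forall k, cabs (y k) <= B) ->
  (exists2 t, ratr p <= t <= ratr q & peak d y (cayley t)) <->
  (forall K : nat, exists2 r : rat, (p <= r <= q)%R & forall H, (H < K)%N ->
     frequently_above (cayley (ratr r)) H.+1 (d - K.+1%:R^-1) y).
Proof.
move=> B0 yB.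
have L0 H : 0 < 4 * B ^+ 2 * H%:R + 1 by rewrite ltr_wpDl// !mulr_ge0// sqr_ge0.
pose L H := 4 * B ^+ 2 * H%:R + 1.
have lip t s H : (0 < H)%N ->
    forall N, `|mean_window (cayley t) H N y - mean_window (cayley s) H N y| <=
      L H * `|t - s| + N%:R^-1 * 0.
  move=> _ N; rewrite mulr0 addr0 (le_trans (mean_window_lip B0 yB _ _ _ _))//.
  by rewrite ler_wpM2r// lerDl.
split=> [[t /andP[pt tq] tP] K|hK].
  pose e : R := K.+1%:R^-1; have e0 : 0 < e by rewrite invr_gt0.
  have eL : 0 < e / 2 / L K.+1 by rewrite !divr_gt0// L0.
  have [r prq rt] : exists2 r : rat, (p <= r <= q)%R & `|ratr r - t| < e / 2 / L K.+1.
    (* The rational is sought just below [t], which would leave the interval if [t] is its left end;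
       there [p] itself serves. *)
    move: pt; rewrite le_eqVlt => /predU1P[pt|pt].
      by exists p; [rewrite lexx /= -(ler_rat R) pt|rewrite pt subrr normr0].
    have tL : Num.max (ratr p) (t - e / 2 / L K.+1) < t by rewrite gt_max pt /= gtrBl.
    have [r] := rat_in_itvoo tL.
    rewrite in_itv /= gt_max => /andP[/andP[pr tr] rt]; exists r.
      by rewrite -!(ler_rat R) (ltW pr) (le_trans (ltW rt)).
    by rewrite ltr0_norm ?subr_lt0// opprB ltrBlDr -ltrBlDl.
  exists r => // H HK; have ed : d - e / 2 < d by rewrite gtrBl divr_gt0.
  apply: (frequently_above_near (lexx 0) (lip (ratr r) t H.+1 isT) _ (tP H _ ed)).
  have : L H.+1 * `|ratr r - t| < e / 2.
    rewrite (@le_lt_trans _ _ (L K.+1 * `|ratr r - t|))//.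
      rewrite ler_wpM2r// lerD2r ler_wpM2l ?mulr_ge0 ?sqr_ge0// ler_nat.
      by rewrite ltnS ltnW.
    by rewrite mulrC -ltr_pdivlMr// L0.
  by rewrite -/e; lra.
have /choice[r rP] K : exists r : rat, (p <= r <= q)%R /\ forall H, (H < K)%N ->
    frequently_above (cayley (ratr r)) H.+1 (d - K.+1%:R^-1) y.
  by have [r] := hK K; exists r.
pose rho K : R := ratr (r K).
have rho_pq K : rho K \in `[ratr p, ratr q].
  by rewrite in_itv /= !ler_rat; exact: (rP K).1.
(* The peak is a cluster point [t] of the approximate peaks [r K]. For given [H] and [a], an [r K]
   close to [t] with [K] large, in particular [H < K], passes its lower bound on to [t] by the
   Lipschitz estimate. *)
have [|t [tpq tcl]] := @segment_compact R (ratr p) (ratr q) (rho @ \oo) _ _.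
  by exists 0%N => // K _; exact: rho_pq.
exists t; first by move: tpq; rewrite /= in_itv.
move=> H a ad; pose e := (d - a) / 4; have e0 : 0 < e by rewrite divr_gt0// subr_gt0.
have [K0 hK0] := @exists_inv_nat_le R 1 e ler01 e0.
have eL : 0 < e / L H.+1 by rewrite divr_gt0// L0.
have [|_ [[K KK0 <-] /= tK]] := tcl [set rho K | K in [set K | (maxn K0 H.+1 <= K)%N]]
    (ball t (e / L H.+1)) _ (nbhsx_ballx _ _ eL).
  by exists (maxn K0 H.+1) => // K hK1; exists K.
move: KK0; rewrite /= geq_max => /andP[K0K HK].
apply: (frequently_above_near (lexx 0) (lip t (rho K) H.+1 isT) _ ((rP K).2 H HK)).
have h1 : K.+1%:R^-1 <= e by have := hK0 K.+1 (leqW K0K); rewrite mulr1.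
have h2 : L H.+1 * `|t - rho K| < e by rewrite mulrC -ltr_pdivlMr// L0.
have e4 : d - a = 4 * e by rewrite /e; field.
move: (L H.+1 * _) (K.+1%:R^-1) h1 h2 => Z z; clearbody e; move: e0 e4; lra.
Qed.

End window_averages.

(** * The Wiener-Wintner theorem for bounded square integrable functions *)

Lemma ae_forall_count d (T : measurableType d) (R : realType)
    (mu : {measure set T -> \bar R}) (I : countType) (P : I -> T -> Prop) :
  (forall i, {ae mu, forall w, P i w}) -> {ae mu, forall w, forall i, P i w}.
Proof.
move=> aeP.
have : {ae mu, forall w, forall n, if unpickle n is Some i then P i w else True}.
  apply: ae_foralln => n; case: (unpickle n : option I) => [i|]; first exact: aeP.
  exact: aeW.
by apply: filterS => w Pw i; have := Pw (pickle i); rewrite pickleK.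
Qed.

Lemma bigcup_measurable_count d (T : measurableType d) (I : countType) (A : set I)
    (F : I -> set T) :
  (forall i, A i -> measurable (F i)) -> measurable (\bigcup_(i in A) F i).
Proof.
move=> mF; rewrite bigcup_mkcond; apply: countable_bigcupT_measurable => // i.
by case: ifPn => //; rewrite inE => /mF.
Qed.

Section wiener_wintner.
Context d (T : measurableType d) (R : realType).
Context (mu : {measure set T -> \bar R}) (tau : T -> T).
Context (tau_mp : measure_preserving mu tau).
Context (g : T -> R[i]) (ng : bounded_L2 mu g).

Let orbit w k := g (iter k tau w).

Let orbit_iter n w k : orbit (iter n tau w) k = orbit w (k + n)%N.
Proof. by rewrite /orbit iterD. Qed.

Let orbit_tau w : orbit (tau w) = fun k => orbit w k.+1.
Proof. by apply/funext => k; rewrite /orbit iterSr. Qed.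

Let bounded_L2_window_avg l H :
  bounded_L2 mu (fun w => avg (fun j => l ^+ j * orbit w j) H).
Proof.
apply: (@bounded_L2_avg _ _ _ mu (fun j w => l ^+ j * g (iter j tau w))) => j.
by apply: bounded_L2Z; exact: bounded_L2_iter.
Qed.

Let bounded_L2_window l H : bounded_L2 mu (fun w => (window l H (orbit w))%:C).
Proof.
have nA := bounded_L2_window_avg l H; have [mA [B B0 AB] Aoo] := nA.
have cabs2 w : cabs ((cabs (avg (fun j => l ^+ j * orbit w j) H))%:C) =
    cabs (avg (fun j => l ^+ j * orbit w j) H).
  by rewrite cabs_real ger0_norm ?cabs_ge0.
have mcA : cmeasurable (fun w => (cabs (avg (fun j => l ^+ j * orbit w j) H))%:C).
  exact/cmeasurable_real/measurable_cabs.
have ncA : bounded_L2 mu (fun w => (cabs (avg (fun j => l ^+ j * orbit w j) H))%:C).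
  split => //; first by exists B => // w; rewrite cabs2.
  by rewrite /sqnorm; under eq_integral do rewrite cabs2.
under eq_fun do rewrite /window expr2 rmorphM.
by apply: bounded_L2M => //; exists B => // w; rewrite cabs2.
Qed.

Let measurable_mean_window l H N :
  measurable_fun setT (fun w => mean_window l H N (orbit w)).
Proof.
apply: measurable_funM; first exact: measurable_cst.
apply: measurable_sum => n.
have [[m _] _ _] := bounded_L2_window l H.
apply: (eq_measurable_fun (fun w => window l H (orbit (iter n tau w)))).
  by move=> w _; congr (window _ _ _); apply/funext => j; rewrite orbit_iter.
apply: (measurableT_comp (f := fun w => window l H (orbit w))) => //.
exact: (measurable_iter tau_mp).
Qed.

Let measurable_frequently_above l H a :
  measurable [set w | frequently_above l H a (orbit w)].
Proof.
rewrite (_ : [set w | _] =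
    \bigcap_N0 \bigcup_(N in [set N | (N0 <= N)%N]) [set w | a < mean_window l H N (orbit w)]).
  apply: bigcapT_measurable => N0; apply: bigcup_measurable => N _.
  by apply: measurable_lt_set => //; exact: measurable_cst.
apply/seteqP; split=> [w fw N0 _|w fw N0].
  by have [N N0N aN] := fw N0; exists N.
by have [N /= N0N aN] := fw N0 I; exists N.
Qed.

Let orbit_bounded : exists2 B : R, 0 <= B & forall w k, cabs (orbit w k) <= B.
Proof. by case: ng => _ [B B0 gB] _; exists B => // w k; exact: gB. Qed.

Let peak_below dl (p r : rat) w :=
  exists2 t, ratr p <= t <= ratr r & peak dl (orbit w) (cayley t).

Let measurable_peak_below dl p r : measurable [set w | peak_below dl p r w].
Proof.
have [B B0 oB] := orbit_bounded.
rewrite (_ : [set w | _] = \bigcap_K \bigcup_(s in [set s : rat | (p <= s <= r)%R])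
    \bigcap_(H in [set H | (H < K)%N])
    [set w | frequently_above (cayley (ratr s)) H.+1 (dl - K.+1%:R^-1) (orbit w)]).
  apply: bigcapT_measurable => K; apply: bigcup_measurable_count.
  by move=> s _; apply: bigcap_measurableType => H _.
apply/seteqP; split=> [w /(exists_peakP _ _ _ B0 (oB w)) pw K _|w pw].
  by have [s ps hs] := pw K; exists s.
apply/(exists_peakP _ _ _ B0 (oB w)) => K.
by have [s ps hs] := pw K I; exists s.
Qed.

(* [ratr q] is a default value, for the intervals without peaks. *)
Let peak_values dl p q w : set R :=
  [set x | x = ratr q \/ exists2 r : rat, (p <= r <= q)%R /\ x = ratr r & peak_below dl p r w].

(** With rational right ends [r], only countably many measurable events enter the infimum, which is
    therefore measurable in [w]. *)
Let first_peak dl p q w : R := inf (peak_values dl p q w).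

Let first_peak_tau dl p q w : first_peak dl p q (tau w) = first_peak dl p q w.
Proof.
have [B B0 oB] := orbit_bounded.
have ps t : peak dl (orbit (tau w)) (cayley t) <-> peak dl (orbit w) (cayley t).
  by rewrite orbit_tau; apply: peak_shift B0 (oB w) _; exact: cabs_cayley.
have pb r : peak_below dl p r (tau w) <-> peak_below dl p r w.
  by split=> -[t pt /ps tP]; exists t.
congr inf; apply/seteqP; split=> x [->|[r pr /pb rP]]; first [by left|by right; exists r].
Qed.

Let has_inf_peak_values dl p q w : has_inf (peak_values dl p q w).
Proof.
split; first by exists (ratr q); left.
exists (Num.min (ratr p) (ratr q)) => x [->|[r [/andP[pr _] ->] _]].
  by rewrite ge_min lexx orbT.
by rewrite ge_min ler_rat pr.
Qed.

Let measurable_first_peak dl p q : measurable_fun setT (first_peak dl p q).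
Proof.
apply: (measurability _ (RGenInftyO.measurableE R)) => _ [_ [x ->] <-].
rewrite setTI (_ : _ @^-1` _ = [set w | ratr q < x] `|`
  \bigcup_(r in [set r : rat | (p <= r <= q)%R /\ ratr r < x]) [set w | peak_below dl p r w]).
  apply: measurableU.
    have [qx|qx] := boolP (ratr q < x).
      by rewrite (_ : [set w | _] = setT)//; apply/seteqP; split.
    by rewrite (_ : [set w | _] = set0)//; apply/seteqP; split.
  by apply: bigcup_measurable_count => r _; exact: measurable_peak_below.
apply/seteqP; split=> w /=.
  rewrite in_itv /= => /inf_lt[|y [->|[r [pr ->] rw]] yx].
  - by exists (ratr q); left.
  - by left.
  - by right; exists r.
rewrite in_itv /= => -[qx|[r [pr rx] rw]].
  apply: le_lt_trans qx; apply: ge_inf; first exact: (has_inf_peak_values _ _ _ _).2.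
  by left.
apply: le_lt_trans rx; apply: ge_inf; first exact: (has_inf_peak_values _ _ _ _).2.
by right; exists r.
Qed.

Let first_peakE dl (p q : rat) w t : ratr p < t < ratr q -> peak dl (orbit w) (cayley t) ->
  (forall s, ratr p <= s <= ratr q -> peak dl (orbit w) (cayley s) -> s = t) ->
  first_peak dl p q w = t.
Proof.
move=> /andP[pt tq] tP uniq_t; apply/eqP; rewrite eq_le; apply/andP; split.
  rewrite leNgt; apply/negP => tm.
  have lt_t : t < Num.min (ratr q) (first_peak dl p q w) by rewrite lt_min tq.
  have [r] := rat_in_itvoo lt_t; rewrite in_itv /= lt_min => /and3P[tr rq].
  rewrite ltNge => /negP; apply; apply: ge_inf; first exact: (has_inf_peak_values _ _ _ _).2.
  right; exists r; last by exists t; rewrite // (ltW pt) ltW.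
  by rewrite -!(ler_rat R) (ltW rq) ltW// (lt_trans pt).
apply: lb_le_inf; first by exists (ratr q); left.
move=> x [->|[r [/andP[pr rq] ->] [s /andP[ps sr] sP]]]; first exact: ltW.
by rewrite -(uniq_t s)// ps (le_trans sr)// ler_rat.
Qed.

(** Along an orbit, [mean_window] is the ergodic average of the function [window], so the ergodic
    theorem with the trivial twist 1 applies. *)
Let ae_regular : {ae mu, forall w, regular (orbit w)}.
Proof.
apply: ae_forall_count => r; apply: ae_forall_count => H.
have := @twisted_ergodic_theorem _ _ _ mu tau tau_mp (fun=> 1) (cmeasurable_cst _ 1)
  (fun=> @ComplexField.Normc.normc1 R) (fun=> erefl) _ (bounded_L2_window (cayley (ratr r)) H).
apply: filterS => w hw e e0; have [l [N hN]] := hw e e0; exists l, N => n /hN.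
congr (cabs (_ - l) <= e); rewrite /mean_window /avg rmorphM fmorphV rmorph_nat rmorph_sum.
congr (_ * _); apply: eq_bigr => k _; rewrite expr1n mul1r; congr (window _ _ _)%:C.
by apply/funext => j; rewrite orbit_iter.
Qed.

Let ae_peaks : {ae mu, forall w, forall (m : nat) (p q : rat),
  quasi_cvg (fun n => avg (fun k =>
    cayley (first_peak m.+1%:R^-1 p q w) ^+ k * orbit w k) n)}.
Proof.
apply: ae_forall_count => m; apply: ae_forall_count => p; apply: ae_forall_count => q.
apply: (twisted_ergodic_theorem tau_mp) => //.
- have mfp := measurable_first_peak m.+1%:R^-1 p q; split.
    apply: (measurableT_comp (f := fun t : R => complex.Re (cayley t))) mfp.
    exact: measurable_Re_cayley.
  apply: (measurableT_comp (f := fun t : R => complex.Im (cayley t))) mfp.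
  exact: measurable_Im_cayley.
- by move=> w; exact: cabs_cayley.
- by move=> w; rewrite first_peak_tau.
Qed.

Lemma isolated_in_finite (A : set R) t : finite_set A ->
  exists2 e, 0 < e & forall s, A s -> `|s - t| < e -> s = t.
Proof.
move=> /finite_seqP[l ->]; elim: l => [|x l [e e0 IH]]; first by exists 1.
have [->|xt] := eqVneq x t.
  by exists e => // s; rewrite /= inE => /predU1P[//|]; exact: IH.
exists (Num.min e `|x - t|); first by rewrite lt_min e0 normr_gt0 subr_eq0.
move=> s; rewrite /= inE lt_min => /predU1P[->|sl] /andP[h1 h2]; last exact: IH.
by rewrite ltxx in h2.
Qed.

(** Three cases at a good point. The value -1, missed by [cayley], has its own constant twist. A
    peak is isolated, hence is the first peak of a small rational interval and falls under
    [ae_peaks]. If [l] is a peak of no height [m.+1%:R^-1], the averages tend to 0 by [not_peak]. *)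
Theorem wiener_wintner : {ae mu, forall w, forall l : R[i], cabs l = 1 ->
  quasi_cvg (fun n => avg (fun k => l ^+ k * g (iter k tau w)) n)}.
Proof.
have [B B0 oB] := orbit_bounded.
have cabsN1 (w : T) : cabs (-1 : R[i]) = 1.
  by rewrite /= sqrrN expr1n oppr0 expr0n addr0 sqrtr1.
have aeN1 := twisted_ergodic_theorem tau_mp (cmeasurable_cst _ (-1)) cabsN1
  (fun=> erefl) ng.
move: aeN1 ae_regular ae_peaks; apply: filterS3 => w hN1 reg hp l l1.
have [->|lN1] := eqVneq l (-1); first exact: hN1.
have [t lt] := cayley_surj l1 lN1; subst l.
have [[m tm]|nop] := pselect (exists m : nat, peak m.+1%:R^-1 (orbit w) (cayley t)).
  have m0 : 0 < m.+1%:R^-1 :> R by rewrite invr_gt0.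
  have [e e0 iso] := isolated_in_finite t (finite_peaks B0 (oB w) reg m0).
  have te : t - e < t by rewrite gtrBl.
  have et : t < t + e by rewrite ltrDl.
  have [p] := rat_in_itvoo te; rewrite in_itv /= => /andP[ep pt].
  have [q] := rat_in_itvoo et; rewrite in_itv /= => /andP[tq qe].
  suff tE : first_peak m.+1%:R^-1 p q w = t by have := hp m p q; rewrite tE.
  apply: first_peakE => //; first by rewrite pt.
  move=> s /andP[ps sq] sP; apply: iso => //.
  by rewrite ltr_distl (lt_le_trans ep)// (le_lt_trans sq).
move=> e e0; have e20 : 0 < e ^+ 2 by rewrite exprn_gt0.
have [m hm] := exists_inv_nat_le ler01 e20.
have nopm : ~ peak m.+1%:R^-1 (orbit w) (cayley t) by move=> h; apply: nop; exists m.
have [N hN] := not_peak B0 (oB w) (cabs_cayley t) nopm.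
exists 0, N => n Nn; rewrite subr0 (le_trans (hN n Nn))//.
rewrite -(@ler_pXn2r _ 2) ?nnegrE ?sqrtr_ge0 ?(ltW e0)// sqr_sqrtr ?invr_ge0//.
by have := hm m.+1 (leqnSn m); rewrite mulr1.
Qed.

End wiener_wintner.

(** * Level sets and tails of the elements of a fully symmetric space *)

Section embedded_space_levels.
Context d (T : measurableType d) (R : realType) (mu : {measure set T -> \bar R}).
Context (E : completeNormedModType R[i]) (rep : E -> T -> R[i]).
Context (mu_infinite : mu [set: T] = +oo%E) (E_fs : fully_symmetric mu rep).
Context (one_notin_E : ~ in_space mu rep (fun _ => 1)).

(* Unlike [ge0_le_integral], without measurability of the integrands. *)
Lemma le_integral_ge0 d' (S : measurableType d') (nu : {measure set S -> \bar R})
    (D : set S) (f1 f2 : S -> \bar R) :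
  (forall x, D x -> 0 <= f1 x)%E -> (forall x, D x -> f1 x <= f2 x)%E ->
  (\int[nu]_(x in D) f1 x <= \int[nu]_(x in D) f2 x)%E.
Proof.
move=> f10 f12; have f20 x : D x -> (0 <= f2 x)%E.
  by move=> Dx; rewrite (le_trans (f10 _ Dx))// f12.
rewrite !ge0_integralE//; apply: le_ereal_sup => _ [h hf <-]; exists h => // x.
by rewrite (le_trans (hf x))//; apply: lee_restrict.
Qed.

Let mu_gt0 : (0 < mu [set: T])%E.
Proof. by rewrite mu_infinite. Qed.

Lemma L1_plus_Loo_cst (l : R) : 0 <= l -> L1_plus_Loo mu (fun=> l%:C).
Proof.
move=> l0; exists (fun=> 0), (fun=> l%:C); split.
- split; first exact: cmeasurable_cst.
  rewrite Lnorm1 integral0_eq// => x _.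
  by rewrite /= -[Num.sqrt _]/(cabs (0 : R[i])) ComplexField.Normc.normc0 normr0.
- split; first exact: cmeasurable_cst.
  rewrite unlock mu_gt0 (le_lt_trans (y := l%:E)) ?ltry//.
  apply/ess_supP; apply: aeW => x /=.
  by rewrite -[Num.sqrt _]/(cabs l%:C) cabs_real !ger0_norm.
- by apply/funext => w; rewrite add0r.
Qed.

(* Otherwise the constant function [l] is submajorized by [f]. *)
Lemma mu_level_lty (f : T -> R[i]) (l : R) : in_space mu rep f -> 0 < l ->
  (mu [set w | (l < cabs (f w))%R] < +oo)%E.
Proof.
move=> [x fx] l0; rewrite ltey; apply/eqP => lf; apply: one_notin_E.
have [sub fs] := E_fs.
have Lg : L1_plus_Loo mu (fun _ : T => l%:C) by apply: L1_plus_Loo_cst; exact: ltW.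
have sm : submajorized mu (fun=> l%:C) f.
  move=> s s0; apply: le_integral_ge0 => t.
    rewrite /= in_itv /= => /andP[t0 _].
    by apply: le_ereal_inf_tmp => _ [u [u0 _] <-]; rewrite lee_fin ltW.
  rewrite /= in_itv /= => /andP[t0 _].
  apply: (@le_trans _ _ l%:E).
    apply: ereal_inf_lbound; exists l => //; split => //.
    rewrite (_ : [set _ | _] = set0) ?measure0 ?lee_fin ?(ltW t0)//.
    apply/seteqP; split=> // w.
    by rewrite /mkset cabs_real gtr0_norm// ltxx.
  (* No [u < l] is admissible in the infimum: its level set contains that of [l], hence has infinite
     measure. *)
  apply: le_ereal_inf_tmp => _ [u [u0 fu] <-]; rewrite lee_fin leNgt; apply/negP => ul.
  move: fu; rewrite leNgt => /negP; apply; rewrite (_ : mu _ = +oo%E) ?ltry//.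
  apply/eqP; rewrite -leye_eq -lf; have [mf _] := fx.
  apply: le_measure; rewrite ?inE.
  - by apply: measurable_lt_set; [exact: measurable_cst|exact: measurable_cabs].
  - by apply: measurable_lt_set; [exact: measurable_cst|exact: measurable_cabs].
  - by move=> w /=; exact: lt_trans.
have [y [_ yl] _] := fs _ _ _ fx Lg sm.
(* This vector is [l^-1] times [y], put in the form [a *: x + y] to which [rep_linear] applies. *)
exists ((l^-1%:C - 1) *: y + y); split; first exact: cmeasurable_cst.
move: yl (rep_linear sub (l^-1%:C - 1) y y); apply: filterS2 => w ly ay _.
rewrite ay// -ly// mulrBl mul1r subrK -rmorphM mulVf ?gt_eqF//.
Qed.

Definition tail (f : T -> R[i]) (c : R) (w : T) : R :=
  if c < cabs (f w) then cabs (f w) else 0.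

Lemma measurable_tail f c : cmeasurable f -> measurable_fun setT (tail f c).
Proof.
move=> mf; apply: measurable_fun_ifT => //; last exact: measurable_cabs.
by apply: measurable_fun_ltr => //; exact: measurable_cabs.
Qed.

Lemma tail_ge0 f c w : 0 <= tail f c w.
Proof. by rewrite /tail; case: ifP => // _; exact: cabs_ge0. Qed.

(* On the finite measure set [|f| > 1], [|f| <= |g| + C] with [g] integrable. *)
Lemma integral_tail1_lty (f : T -> R[i]) : in_space mu rep f ->
  (\int[mu]_w (tail f 1 w)%:E < +oo)%E.
Proof.
move=> inf; have A1 := mu_level_lty inf ltr01; have [x [mf fx]] := inf.
have [sub _] := E_fs.
have [g [h [[mg g1] [mh hoo] rE]]] := rep_L1_plus_Loo sub x.
have [C C0 hC] : exists2 C : R, 0 <= C & {ae mu, forall w, (cabs (h w) <= C)%R}.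
  move: hoo; rewrite unlock mu_gt0 => hoo.
  have := ess_sup_ge mu (abse \o (EFin \o @cabs R \o h)).
  move: hoo; case: (ess_sup _ _) => [r| |] // _.
    move=> ae; exists `|r| => //; move: ae; apply: filterS => w /=.
    by rewrite lee_fin ger0_norm ?cabs_ge0// => /le_trans; apply; exact: ler_norm.
  by move=> ae; exists 0 => //; move: ae; apply: filterS => w /=; rewrite leeNy_eq.
pose A := [set w | 1 < cabs (f w)].
have mA : measurable A.
  by apply: measurable_lt_set; [exact: measurable_cst|exact: measurable_cabs].
apply: (@le_lt_trans _ _ (\int[mu]_w ((cabs (g w))%:E + C%:E * (\1_A w)%:E))%E).
  apply: ae_ge0_le_integral => //.
  - by move=> w _; rewrite lee_fin tail_ge0.
  - exact/measurable_EFinP/measurable_tail.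
  - by move=> w _; rewrite -EFinM -EFinD lee_fin addr_ge0 ?cabs_ge0// mulr_ge0.
  - apply: emeasurable_funD; first exact/measurable_EFinP/measurable_cabs.
    by apply/measurable_EFinP/measurable_funM => //; exact: measurable_indic.
  move: fx hC; apply: filterS2 => w /(_ I) fw hw _.
  rewrite -EFinM -EFinD lee_fin /tail; case: ifPn => [fw1|_].
    rewrite indicE mem_set// mulr1 fw rE (le_trans (ler_cabsD _ _))// lerD2l//.
  by rewrite addr_ge0 ?cabs_ge0// mulr_ge0.
rewrite ge0_integralD//; last 4 first.
- by move=> w _; rewrite lee_fin cabs_ge0.
- exact/measurable_EFinP/measurable_cabs.
- by move=> w _; rewrite -EFinM lee_fin mulr_ge0.
- by apply/measurable_EFinP/measurable_funM => //; exact: measurable_indic.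
rewrite lte_add_pinfty//.
  move: g1; rewrite Lnorm1; congr (_ < _)%E; apply: eq_integral => w _ /=.
  by rewrite ger0_norm ?cabs_ge0.
rewrite ge0_integralZl_EFin//; last exact/measurable_EFinP/measurable_indic.
rewrite integral_indic// setIT lte_mul_pinfty ?lee_fin// ge0_fin_numE//.
Qed.

(** Dominated convergence: at each point the tails vanish once the level exceeds [|f|], and
    [tail f 1] dominates them all. *)
Lemma integral_tail_small (f : T -> R[i]) (e : R) : in_space mu rep f -> 0 < e ->
  exists k : nat, (\int[mu]_w (tail f k.+1%:R w)%:E <= e%:E)%E.
Proof.
move=> inf e0; have [x [mf _]] := inf.
have t1 := integral_tail1_lty inf.
have tl c w : 1 <= c -> tail f c w <= tail f 1 w.
  rewrite /tail => c1; case: ifPn => [/(le_lt_trans c1) ->//|_].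
  by case: ifP => // _; exact: cabs_ge0.
have cvg0 : (\int[mu]_w (tail f k.+1%:R w)%:E)%E @[k --> \oo] --> (\int[mu]_w (cst 0 w))%E.
  apply: (@dominated_cvg _ _ _ mu setT measurableT
    (fun k w => (tail f k.+1%:R w)%:E) (cst 0%E) (fun w => (tail f 1 w)%:E)) => //.
  - by move=> k; exact/measurable_EFinP/measurable_tail.
  - move=> w _; apply: cvg_near_cst; exists (Num.truncn (cabs (f w))).+1 => // k /= wk.
    rewrite /tail ltNge (le_trans (ltW (truncnS_gt _)))//.
    by rewrite ler_nat (leq_trans wk).
  - apply/integrableP; split; first exact/measurable_EFinP/measurable_tail.
    by under eq_integral do rewrite gee0_abs ?lee_fin ?tail_ge0//.
  - by move=> k w _; rewrite gee0_abs ?lee_fin ?tail_ge0// tl// ler1n.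
rewrite integral0 in cvg0; apply: contrapT => /forallNP h.
have : (e%:E <= limn (fun k => \int[mu]_w (tail f k.+1%:R w)%:E))%E.
  apply: lime_ge; first by apply/cvg_ex; exists 0%E.
  by apply: nearW => k; rewrite ltW// ltNge; apply/negP; exact: h.
by rewrite (cvg_lim _ cvg0)// lee_fin leNgt e0.
Qed.

End embedded_space_levels.

(** * From powers to Besicovitch weights *)

Section besicovitch_weights.
Context (R : realType).
Implicit Types (u v y z b : nat -> R[i]).

Lemma limn_esup_lt_eventually (u : nat -> R) (e : R) :
  (limn_esup (fun n => (u n)%:E) < e%:E)%E -> exists N, forall n, (N <= n)%N -> u n < e.
Proof.
rewrite /limn_esup /limf_esup => /ereal_inf_lt[_ [V [N _ NV] <-] Ve].
exists N => n Nn; rewrite -lte_fin (le_lt_trans _ Ve)//.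
by apply: ereal_sup_ubound; exists n => //; exact: NV.
Qed.

Lemma quasi_cvgD u v : quasi_cvg u -> quasi_cvg v -> quasi_cvg (fun n => u n + v n).
Proof.
move=> hu hv e e0; have e2 : 0 < e / 2 by rewrite divr_gt0.
have [l [N hN]] := hu _ e2; have [l' [N' hN']] := hv _ e2.
exists (l + l'), (maxn N N') => n; rewrite geq_max => /andP[/hN h1 /hN' h2].
rewrite opprD addrACA (le_trans (ler_cabsD _ _))//; move: h1 h2; lra.
Qed.

Lemma quasi_cvgZ c u : quasi_cvg u -> quasi_cvg (fun n => c * u n).
Proof.
move=> hu e e0; have c0 : 0 < cabs c + 1 by rewrite ltr_wpDl ?cabs_ge0.
have [|l [N hN]] := hu (e / (cabs c + 1)); first by rewrite divr_gt0.
exists (c * l), N => n /hN h; rewrite -mulrBr ComplexField.Normc.normcM.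
rewrite (@le_trans _ _ ((cabs c + 1) * cabs (u n - l)))//.
  by rewrite ler_wpM2r ?cabs_ge0// lerDl.
by rewrite mulrC -ler_pdivlMr.
Qed.

Lemma quasi_cvg_sum s (F : 'I_s -> nat -> R[i]) : (forall j, quasi_cvg (F j)) ->
  quasi_cvg (fun n => \sum_j F j n).
Proof.
move=> hF; elim: s F hF => [|s IH] F hF.
  move=> e e0; exists 0, 0%N => n _.
  by rewrite big_ord0 subrr ComplexField.Normc.normc0 ltW.
under eq_fun do rewrite big_ord_recl; apply: quasi_cvgD => //.
by apply: IH => j; exact: hF.
Qed.

Lemma quasi_cvg_approx u : (forall e : R, 0 < e -> exists2 v, quasi_cvg v &
    exists N, forall n, (N <= n)%N -> cabs (u n - v n) <= e) -> quasi_cvg u.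
Proof.
move=> hu e e0; have e2 : 0 < e / 2 by rewrite divr_gt0.
have [v hv [N uv]] := hu _ e2; have [l [N' hN']] := hv _ e2.
exists l, (maxn N N') => n; rewrite geq_max => /andP[/uv h1 /hN' h2].
rewrite (le_trans (ler_cabs_dist (v n) _ _))//; move: h1 h2; lra.
Qed.

Lemma quasi_cvg_trig y P : trigonometric_polynomial P ->
  (forall l, cabs l = 1 -> quasi_cvg (avg (fun k => l ^+ k * y k))) ->
  quasi_cvg (avg (fun k => P k%:Z * y k)).
Proof.
move=> [s [z [lam [lam1 PE]]]] hy.
rewrite (_ : avg _ = fun n => \sum_j z j * avg (fun k => lam j ^+ k * y k) n).
  apply: quasi_cvg_sum => j; apply: quasi_cvgZ; apply: hy.
  by apply: (@complexI R); rewrite -normE lam1.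
apply/funext => n; under [RHS]eq_bigr do rewrite -avgZ.
rewrite -avg_sum; apply: eq_avg => k; rewrite PE mulr_suml.
by apply: eq_bigr => j _; rewrite mulrA exprnP.
Qed.

(** Write [b y - P z = b (y - z) + (b - P) z]. The first term is controlled by the bound of [b], the
    second by that of [z]; so [z] is chosen first, and the precision of [P] depends on it. Adding 1
    to the bounds keeps the denominators positive. *)
Lemma quasi_cvg_besicovitch y b : bounded_besicovitch b ->
  (forall e : R, 0 < e -> exists z, [/\ exists B : R, forall k, cabs (z k) <= B,
      forall l, cabs l = 1 -> quasi_cvg (avg (fun k => l ^+ k * z k)) &
      forall n, avg (fun k => cabs (y k - z k)) n <= e]) ->
  quasi_cvg (avg (fun k => b k * y k)).
Proof.
move=> [[C bC] bP] hy; apply: quasi_cvg_approx => e e0.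
have C0 : 0 <= C by rewrite (le_trans (cabs_ge0 _) (bC 0%N)).
have C1 : 0 < C + 1 by rewrite ltr_wpDl.
have eC : 0 < e / 2 / (C + 1) by rewrite !divr_gt0.
have [z [[B zB] zW yz]] := hy _ eC.
have B0 : 0 <= B by rewrite (le_trans (cabs_ge0 _) (zB 0%N)).
have B1 : 0 < B + 1 by rewrite ltr_wpDl.
have eB : 0 < e / 2 / (B + 1) by rewrite !divr_gt0.
have [P tP /limn_esup_lt_eventually[N hN]] := bP _ eB.
exists (avg (fun k => P k%:Z * z k)); first exact: quasi_cvg_trig.
exists N => n /hN bPn; rewrite -avgB.
rewrite (@eq_avg _ _ (fun k => b k * (y k - z k) + (b k - P k%:Z) * z k)); last first.
  by move=> k; ring.
rewrite avgD (le_trans (ler_cabsD _ _))// [leRHS](splitr e) lerD//.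
  rewrite (le_trans (ler_cabs_avg _ _))//.
  apply: (@le_trans _ _ (avg (fun k => (C + 1) * cabs (y k - z k)) n)).
    apply: ler_avg => k; rewrite ComplexField.Normc.normcM ler_wpM2r ?cabs_ge0//.
    by rewrite (le_trans (bC k))// lerDl.
  by rewrite avgZ mulrC -ler_pdivlMr.
rewrite (le_trans (ler_cabs_avg _ _))//.
apply: (@le_trans _ _ (avg (fun k => (B + 1) * cabs (b k - P k%:Z)) n)).
  apply: ler_avg => k; rewrite ComplexField.Normc.normcM mulrC ler_wpM2r ?cabs_ge0//.
  by rewrite (le_trans (zB k))// lerDl.
by rewrite avgZ mulrC -ler_pdivlMr// ltW.
Qed.

Lemma quasi_cvg_cvgn (u : nat -> R[i]^o) : quasi_cvg u -> cvgn u.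
Proof.
move=> hu.
have cR (F : R[i] -> R) : (forall x y : R[i], `|F x - F y| <= cabs (x - y)) ->
    cvgn (fun n => F (u n) : R).
  move=> F1; apply/cauchy_cvgP/cauchy_exP => e e0; have e2 : 0 < e / 2 by rewrite divr_gt0.
  have [l [N hN]] := hu _ e2; exists (F l); exists N => // n /= Nn.
  rewrite /ball /= distrC (le_lt_trans (F1 _ _))// (le_lt_trans (hN _ Nn))//.
  by rewrite ltr_pdivrMr// ltr_pMr// ltr1n.
have ReB (x y : R[i]) : complex.Re (x - y) = complex.Re x - complex.Re y.
  by case: x; case: y.
have ImB (x y : R[i]) : complex.Im (x - y) = complex.Im x - complex.Im y.
  by case: x; case: y.
have /cvg_ex[a /cvgrPdist_le ua] : cvgn (fun n => complex.Re (u n) : R).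
  by apply: (cR (@complex.Re R)) => x y; rewrite -ReB Re_le_cabs.
have /cvg_ex[b /cvgrPdist_le ub] : cvgn (fun n => complex.Im (u n) : R).
  by apply: (cR (@complex.Im R)) => x y; rewrite -ImB Im_le_cabs.
apply/cvg_ex; exists (a +i* b : R[i]^o); apply/cvgrPdist_le => e e0.
(* The radius [e] lives in [R[i]], where positivity includes being real. *)
have [eI eR] : complex.Im e = 0 /\ 0 < complex.Re e.
  by move: e0; rewrite ltcE /= => /andP[/eqP -> ->].
have eE : e = (complex.Re e)%:C by move: eI; case: (e) => r s /= ->.
have e2 : 0 < complex.Re e / 2 by rewrite divr_gt0.
move: (ua _ e2) (ub _ e2); apply: filterS2 => n an bn.
rewrite eE -[`|_|]/(`|(a +i* b : R[i]) - (u n : R[i])|) normE lecR.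
rewrite (le_trans (cabs_le_ReIm _))// ReB ImB /= [leRHS](splitr (complex.Re e)).
exact: lerD.
Qed.

End besicovitch_weights.

(** * Truncation and conclusion *)

Section truncation.
Context d (T : measurableType d) (R : realType) (mu : {measure set T -> \bar R}).
Implicit Types f : T -> R[i].

(** The lower cut gives a support of finite measure, the upper one a bounded function; together they
    lead to [bounded_L2]. *)
Definition truncation f (a b : R) (w : T) : R[i] :=
  if a < cabs (f w) <= b then f w else 0.

Lemma dist_truncation f a b w : 0 <= a ->
  cabs (f w - truncation f a b w) <= a + tail f b w.
Proof.
move=> a0; rewrite /truncation /tail.
have [fa|fa] := leP (cabs (f w)) a.
  by rewrite /= subr0 (le_trans fa)// lerDl; case: ifP => // _; exact: cabs_ge0.
by case: leP => _ /=; rewrite ?subrr ?ComplexField.Normc.normc0 ?addr0// subr0 lerDr.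
Qed.

Lemma bounded_L2_truncation f a b : cmeasurable f -> 0 <= b ->
  (mu [set w | (a < cabs (f w))%R] < +oo)%E -> bounded_L2 mu (truncation f a b).
Proof.
move=> mf b0 fa.
have mA : measurable [set w | a < cabs (f w)].
  by apply: measurable_lt_set; [exact: measurable_cst|exact: measurable_cabs].
have mB : measurable (~` [set w | b < cabs (f w)]).
  by apply/measurableC/measurable_lt_set; [exact: measurable_cst|exact: measurable_cabs].
have bnd w : cabs (truncation f a b w) <= b.
  by rewrite /truncation; case: ifP => [/andP[]//|_]; rewrite ComplexField.Normc.normc0.
have mt : cmeasurable (truncation f a b).
  pose AB := [set w | a < cabs (f w)] `&` ~` [set w | b < cabs (f w)].
  rewrite (_ : truncation _ _ _ = fun w => (\1_AB w)%:C * f w); last first.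
    apply/funext => w; rewrite /truncation indicE; case: ifPn => [/andP[aw wb]|nab].
      rewrite mem_set ?mul1r//; split => //=.
      by apply/negP; rewrite -leNgt.
    rewrite memNset ?mul0r// => -[/= aw /negP]; rewrite -leNgt => wb.
    by rewrite aw wb in nab.
  apply: cmeasurableM => //; apply: cmeasurable_real; apply: measurable_indic.
  exact: measurableI.
split => //; first by exists b.
apply: (@le_lt_trans _ _ (\int[mu]_w ((b ^+ 2)%:E * (\1_[set w | (a < cabs (f w))%R] w)%:E))%E).
  apply: ge0_le_integral => //.
  - by move=> w _; rewrite lee_fin sqr_ge0.
  - exact/measurable_EFinP/measurable_cabs2.
  - by apply/measurable_EFinP/measurable_funM => //; exact: measurable_indic.
  move=> w _; rewrite -EFinM lee_fin indicE.
  have [aw|aw] := boolP (a < cabs (f w)).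
    by rewrite mem_set// mulr1 lerXn2r ?nnegrE ?cabs_ge0.
  rewrite /truncation (negbTE aw) /= -[Num.sqrt _]/(cabs (0 : R[i])).
  by rewrite ComplexField.Normc.normc0 expr0n mulr_ge0 ?sqr_ge0.
rewrite ge0_integralZl_EFin ?sqr_ge0//; last exact/measurable_EFinP/measurable_indic.
by rewrite integral_indic// setIT lte_mul_pinfty ?lee_fin ?sqr_ge0.
Qed.

End truncation.

(** The exceptional set lies in every [max_set tau (h k) l], whose measure is at most the integral
    of [h k] divided by [l], hence arbitrarily small. *)
Lemma ae_exists_notin_max_set d (T : measurableType d) (R : realType)
    (mu : {measure set T -> \bar R}) (tau : T -> T) (h : nat -> T -> R) :
  measure_preserving mu tau -> (forall k, measurable_fun setT (h k)) ->
  (forall k w, 0 <= h k w) ->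
  (forall e : R, 0 < e -> exists k, (\int[mu]_w (h k w)%:E <= e%:E)%E) ->
  forall l : R, 0 < l -> {ae mu, forall w, exists k, ~ max_set tau (h k) l w}.
Proof.
move=> tau_mp mh h0 hsmall l l0.
have mM k : measurable (max_set tau (h k) l) by exact: (measurable_max_set tau_mp).
exists (\bigcap_k max_set tau (h k) l); split; first exact: bigcapT_measurable.
  apply/eqP; rewrite eq_le measure_ge0 andbT; apply/lee_addgt0Pr => e e0.
  rewrite add0e; have [k hk] := hsmall _ (mulr_gt0 l0 e0).
  apply: (@le_trans _ _ (mu (max_set tau (h k) l))).
    apply: le_measure; rewrite ?inE//; first exact: bigcapT_measurable.
    by move=> w; apply.
  rewrite -(@lee_pmul2l _ l%:E)//.
  by rewrite (le_trans (maximal_inequality tau_mp (mh k) (h0 k) l0)).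
by move=> w /= nw k _; apply: contrapT => nk; apply: nw; exists k.
Qed.

Theorem theorem6p7 (R : realType) (d : measure_display) (T : measurableType d)
    (mu : {measure set T -> \bar R}) (tau : T -> T)
    (E : completeNormedModType R[i]) (rep : E -> T -> R[i])
    (mu_complete : measure_is_complete mu)
    (mu_infinite : mu [set: T] = +oo%E)
    (tau_mp : measure_preserving mu tau)
    (E_fs : fully_symmetric mu rep)
    (one_notin_E : ~ in_space mu rep (fun _ => 1)) :
  forall f : T -> R[i], in_space mu rep f ->
    exists Omega_f : set T,
      [/\ measurable Omega_f, mu ([set: T] `\` Omega_f) = 0%E &
        forall (w : T) (b : nat -> R[i]),
          Omega_f w -> bounded_besicovitch b ->
          cvgn (weighted_average tau b f w)].
Proof.
move=> f inf; have [x [mf _]] := inf.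
have level l : 0 < l -> (mu [set w | (l < cabs (f w))%R] < +oo)%E.
  exact: (mu_level_lty mu_infinite E_fs one_notin_E inf).
have inv0 m : 0 < m.+1%:R^-1 :> R by rewrite invr_gt0.
(* Cuts of the form [n.+1%:R^-1] and [k.+1%:R] are countably many, so a single null set serves all
   weights and all precisions. *)
have aeW : {ae mu, forall w, forall n k (l : R[i]), cabs l = 1 -> quasi_cvg
    (avg (fun j => l ^+ j * truncation f n.+1%:R^-1 k.+1%:R (iter j tau w)))}.
  apply: ae_foralln => n; apply: ae_foralln => k.
  apply: (wiener_wintner tau_mp); apply: bounded_L2_truncation => //.
  exact: level.
have aeM : {ae mu, forall w, forall m, exists k,
    ~ max_set tau (tail f k.+1%:R) m.+1%:R^-1 w}.
  apply: ae_foralln => m.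
  apply: (ae_exists_notin_max_set (h := fun k => tail f k.+1%:R) tau_mp) => //.
  - by move=> k; exact: measurable_tail.
  - by move=> k w; exact: tail_ge0.
  - by move=> e e0; exact: (integral_tail_small mu_infinite E_fs one_notin_E inf).
have : {ae mu, forall w, forall b, bounded_besicovitch b ->
    cvgn (weighted_average tau b f w)}.
  move: aeW aeM; apply: filterS2 => w ww mw b bb; apply: quasi_cvg_cvgn.
  apply: (quasi_cvg_besicovitch (y := fun k => f (iter k tau w)) bb) => e e0.
  have e2 : 0 < e / 2 by rewrite divr_gt0.
  (* The same [m] plays two roles: it is the lower cut of the truncation and the bound for the
     averages of the upper tail. Each contributes at most [e / 2]. *)
  have [m hm] := exists_inv_nat_le ler01 e2; have [k notM] := mw m.
  exists (fun j => truncation f m.+1%:R^-1 k.+1%:R (iter j tau w)); split => //.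
  - exists k.+1%:R => j; rewrite /truncation; case: ifP => [/andP[]//|_].
    by rewrite ComplexField.Normc.normc0.
  - exact: ww.
  move=> n; have me : m.+1%:R^-1 <= e / 2 :> R by have := hm m.+1 (leqnSn m); rewrite mulr1.
  case: n => [|n]; first by rewrite /avg big_ord0 mulr0 ltW.
  apply: (@le_trans _ _ (avg (fun j => m.+1%:R^-1 + tail f k.+1%:R (iter j tau w)) n.+1)).
    by apply: ler_avg => j; apply: dist_truncation; exact: ltW.
  rewrite avgD avg_cst// [leRHS](splitr e) lerD// (le_trans _ me)//.
  rewrite /avg mulrC ler_pdivrMr// leNgt; apply/negP => lt; apply: notM.
  by exists n.+1.
move=> [N [mN N0 subN]]; exists (~` N); split.
- exact: measurableC.
- by rewrite setTD setCK.
- by move=> w b Nw bb; apply: contrapT => nc; apply: Nw; apply: subN => /(_ _ bb).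
Qed.
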